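(* Let $T>0$ and let $(\Omega,(\mathcal{F}_t)_{t\in[0,T]},P)$ be a filtered probability space satisfying the usual conditions, with $\mathcal{F}_0$ trivial and $\mathcal{F}=\mathcal{F}_T$. Let $n\ge 1$, $\delta\in(0,1)$ and \[ \mathcal{O}=\Big\{x\in(0,\infty)^n:\ \max_{j}\frac{x_j}{x_1+\cdots+x_n}<1-\delta\Big\}. \] Let $S=(S(t))_{t\in[0,T]}$ be a continuous adapted process taking values in $\mathcal{O}$ which has conditional full support in $\mathcal{O}$. Then for every $\varepsilon>0$ there exists an $\varepsilon$-consistent price system $(\tilde S,Q)$ to $S$ such that $\tilde S$ takes values in $\mathcal{O}$.
   Context: Conditional full support: for an open set $\mathcal{O}\subset\mathbb{R}^n$ and a continuous adapted $\mathcal{O}$-valued process $(S(t))_{t\in[0,T]}$, we say $S$ has conditional full support in $\mathcal{O}$ if for all $t\in[0,T]$ and every open set $G\subset C([0,T],\mathcal{O})$ (topology of uniform convergence), $P(S\in G\mid\mathcal{F}_t)>0$ almost surely on the event $\{S|_{[0,t]}\in\{g|_{[0,t]}: g\in G\}\}$. An $\varepsilon$-consistent price system to $S$ is a pair $(\tilde S,Q)$ where $Q$ is a probability measure equivalent to $P$ and $\tilde S$ is a $Q$-martingale in the filtration $(\mathcal{F}_t)$ (not required to be continuous) such that $\frac{1}{1+\varepsilon}\le \tilde S_i(t)/S_i(t)\le 1+\varepsilon$ almost surely for all $t\in[0,T]$ and $i=1,\dots,n$. *)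

(* Defs.v *)
From HB Require Import structures.
From mathcomp Require Import all_boot all_order all_algebra.
From mathcomp Require Import all_classical all_reals all_analysis.
Set Implicit Arguments. Unset Strict Implicit. Unset Printing Implicit Defensive.
Import Order.TTheory GRing.Theory Num.Theory.
Import numFieldNormedType.Exports.
Local Open Scope classical_set_scope.
Local Open Scope ring_scope.

Definition in_time {R : realType} (T t : R) : Prop := 0 <= t <= T.

Definition G_measurable {d} {Omega : measurableType d} {R : realType}
  (G : set (set Omega)) (f : Omega -> R) : Prop :=
  forall B : set R, measurable B -> G (f @^-1` B).

Definition is_cond_exp {d} {Omega : measurableType d} {R : realType}
  (mu : probability Omega R) (G : set (set Omega)) (X Y : Omega -> R) : Prop :=
  [/\ measurable_fun setT X, mu.-integrable setT (EFin \o X),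
      G_measurable G Y, mu.-integrable setT (EFin \o Y) &
      forall A, G A ->
        (\int[mu]_(x in A) (X x)%:E = \int[mu]_(x in A) (Y x)%:E)%E].

Definition usual_filtration {d} {Omega : measurableType d} {R : realType}
  (P : probability Omega R) (T : R) (F : R -> set (set Omega)) : Prop :=
  [/\ (forall t, in_time T t -> sigma_algebra setT (F t) /\ F t `<=` measurable),
      (forall s t, 0 <= s -> s <= t -> t <= T -> F s `<=` F t),
      (forall t, 0 <= t -> t < T ->
         forall A, (forall u, t < u -> u <= T -> F u A) -> F t A),
      ((forall N M : set Omega, measurable M -> P M = 0%E -> N `<=` M ->
         measurable N) /\
       (forall N, measurable N -> P N = 0%E -> F 0 N)) &
      ((forall A, F 0 A -> P A = 0%E \/ P A = 1%E) /\
       F T = measurable)].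

Definition Oset {R : realType} (n : nat) (delta : R) (x : 'I_n -> R) : Prop :=
  (forall j, 0 < x j) /\
  \big[Order.max/0]_(j < n) (x j / \sum_(i < n) x i) < 1 - delta.

(** C([0,T], O) : paths continuous on [0,T] with values in O on [0,T]
    (a path is represented by a function R -> R^n; only its restriction to
    [0,T] matters) *)
Definition Cpath {R : realType} (n : nat) (delta T : R) (g : R -> 'I_n -> R) : Prop :=
  (forall i, {within `[0, T], continuous (fun t => g t i)}) /\
  (forall t, in_time T t -> Oset delta (g t)).

Definition open_Cpaths {R : realType} (n : nat) (delta T : R)
  (G : set (R -> 'I_n -> R)) : Prop :=
  G `<=` Cpath delta T /\
  forall g, G g -> exists2 e : R, 0 < e &
    forall h, Cpath delta T h ->
      (forall t i, in_time T t -> `|h t i - g t i| < e) -> G h.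

Definition cont_adapted_O {d} {Omega : measurableType d} {R : realType} (n : nat)
  (delta T : R) (F : R -> set (set Omega)) (S : R -> Omega -> 'I_n -> R) : Prop :=
  [/\ (forall t i, in_time T t -> G_measurable (F t) (fun w => S t w i)),
      (forall w i, {within `[0, T], continuous (fun t => S t w i)}) &
      (forall w t, in_time T t -> Oset delta (S t w))].

Definition CFS {d} {Omega : measurableType d} {R : realType} (n : nat)
  (delta T : R) (P : probability Omega R) (F : R -> set (set Omega))
  (S : R -> Omega -> 'I_n -> R) : Prop :=
  forall t, in_time T t -> forall G, open_Cpaths delta T G ->
    exists2 Y : Omega -> R,
      is_cond_exp P (F t)
        (\1_[set w | G (fun s => S s w)] : Omega -> R) Y &
      {ae P, forall w,
         (exists2 g, G g & forall s, 0 <= s <= t -> S s w = g s) -> 0 < Y w}.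

Definition equiv_prob {d} {Omega : measurableType d} {R : realType}
  (P Q : probability Omega R) : Prop :=
  forall A, measurable A -> (P A = 0%E <-> Q A = 0%E).

Definition martingale {d} {Omega : measurableType d} {R : realType} (n : nat)
  (T : R) (Q : probability Omega R) (F : R -> set (set Omega))
  (St : R -> Omega -> 'I_n -> R) : Prop :=
  forall s t i, 0 <= s -> s <= t -> t <= T ->
    is_cond_exp Q (F s) (fun w => St t w i) (fun w => St s w i).

Definition eps_CPS {d} {Omega : measurableType d} {R : realType} (n : nat)
  (T eps : R) (P : probability Omega R) (F : R -> set (set Omega))
  (S : R -> Omega -> 'I_n -> R) (St : R -> Omega -> 'I_n -> R)
  (Q : probability Omega R) : Prop :=
  [/\ equiv_prob P Q, martingale T Q F St &
      {ae P, forall w, forall t i, in_time T t ->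
         (1 + eps)^-1 <= St t w i / S t w i <= 1 + eps}].

(* Main.v *)
(** An equivalent martingale measure is not constructed for S itself: it suffices to
find a density Z under which, for every fixed time t, the conditional expectation
of S_T given F_t is close to S_t. That conditional expectation is then a
consistent price, and it stays in the convex cone O.

To obtain Z, let p_t be the conditional probability given F_t that the path stays
frozen within rho (in logarithmic distance) of its position at t. Conditional full
support at fixed times and Doob's maximal inequality give inf p_t > 0 over a
countable dense set of times, almost surely. Charge each chain of times for its
large steps, a step starting at time a costing its size times
- ln (eta * inf_(s <= a) p_s), and let Z = exp (- V), where V is the supremum of
the costs of all chains. Given F_t, freezing at t costs little and has conditional
probability p_t, while moving away costs so much that it contributes at most a
factor eta of the weight of freezing. *)

Require Import Defs.
From HB Require Import structures.
From mathcomp Require Import all_boot all_order all_algebra.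
From mathcomp Require Import all_classical all_reals all_analysis.
From mathcomp Require Import measurable_realfun ring lra.
Set Implicit Arguments. Unset Strict Implicit. Unset Printing Implicit Defensive.
Import Order.TTheory GRing.Theory Num.Theory.
Import numFieldNormedType.Exports.
Local Open Scope classical_set_scope.
Local Open Scope ring_scope.

(** * Conditional expectation on a sub-sigma-algebra *)

(** Three obstacles shape the construction. The process p is not a martingale, since its event
    changes with t. Doob's argument is therefore run against a lower bound, the conditional
    probability of one event not depending on t, over short time intervals on which the path has not
    moved by [rho / 2]; uniform continuity covers [0,T] by finitely many of them. The running
    infimum makes the rate nondecreasing in time. When the path freezes at t, only the step
    straddling t costs more, by at most one unit of size at a rate no larger than that of t, so the
    price of freezing is bounded by a quantity known at time t. Moving far must lose against
    freezing although prices may grow like exp D at logarithmic distance D. A move beyond [6 * rho]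
    costs at least 2 L + D, with L the rate: D offsets the growth, one L matches the price of
    freezing, the other supplies the factor eta * p_t. Costs are computed at rational multiples of T
    only, so countably many versions p_t are controlled jointly; the other times are reached by
    limits from the right. *)

Section SubSigmaAlgebra.
Context {d : measure_display} {Omega : measurableType d} {R : realType}.
Variable G : set (set Omega).
Hypothesis sG : sigma_algebra setT G.
Hypothesis Gm : G `<=` measurable.

(** Gives access to the closure properties of measurable functions on the space carrying [G]
    alone. *)
Lemma G_measurableE (f : Omega -> R) :
  G_measurable G f <-> measurable_fun setT (f : g_sigma_algebraType G -> R).
Proof.
split => [Gf _ B mB|mf B mB].
- by rewrite setTI measurable_g_measurableTypeE//; exact: Gf.
- by have := mf measurableT B mB; rewrite setTI measurable_g_measurableTypeE.
Qed.

Lemma sub_measurableP (A : set Omega) :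
  measurable (A : set (g_sigma_algebraType G)) <-> G A.
Proof. by rewrite measurable_g_measurableTypeE. Qed.

Lemma G_measurable_measurable (f : Omega -> R) :
  G_measurable G f -> measurable_fun setT f.
Proof. by move=> Gf _ B mB; rewrite setTI; apply: Gm; exact: Gf. Qed.

Import HBNNSimple.

(** The simple functions approximating [h] are built on the space carrying [G], so their level sets
    lie in [G] and the right-hand side sees [mu] and [f] only through integrals over sets of [G]. *)
Lemma integral_mul_limit (h : Omega -> R)
    (mh : measurable_fun setT (EFin \o h : g_sigma_algebraType G -> \bar R))
    (mu : {measure set Omega -> \bar R}) (f : Omega -> R) (A : set Omega) :
  measurable_fun setT f -> (forall x, 0 <= f x) ->
  (forall x, 0 <= h x) -> G A ->
  let hn := nnsfun_approx (@measurableT _ (g_sigma_algebraType G)) mh in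
  (\int[mu]_(x in A) (h x * f x)%:E =
  limn (fun n => \sum_(r \in range (hn n))
     r%:E * \int[mu]_(x in A `&` hn n @^-1` [set r]) (f x)%:E))%E.
Proof.
move=> mf f0 h0 GA hn.
have mA : measurable A := Gm GA.
have mhn n : measurable_fun setT (hn n : Omega -> R).
  apply: G_measurable_measurable; apply/G_measurableE.
  exact: measurable_funPT.
have mhnp n r : measurable ((hn n : Omega -> R) @^-1` [set r]).
  by rewrite -[X in measurable X]setTI; apply: mhn.
have hnh x : (hn n x)%:E @[n --> \oo] --> (h x)%:E.
  by apply: (@cvg_nnsfun_approx _ _ _ _ _ _ mh) => //= y _; rewrite lee_fin.
transitivity (limn (fun n => \int[mu]_(x in A) (hn n x * f x)%:E))%E.
  rewrite -monotone_convergence//.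
  - apply: eq_integral => x _; apply/esym/cvg_lim => //.
    under eq_fun do rewrite EFinM.
    by rewrite EFinM; apply: cvgeZr => //; exact: hnh.
  - by move=> n; apply/measurable_EFinP/measurable_funTS/measurable_funM.
  - by move=> n x _; rewrite lee_fin mulr_ge0.
  - move=> x _ m n mn; rewrite lee_fin ler_wpM2r//.
    by have /lefP := @nd_nnsfun_approx _ _ _ _ measurableT _ mh _ _ mn.
congr (limn _); apply/funext => n.
have fr : finite_set (range (hn n)) by exact: fimfunP.
transitivity (\int[mu]_(x in A) (\sum_(r \in range (hn n))
    (r * \1_((hn n : Omega -> R) @^-1` [set r]) x * f x)%:E))%E.
  apply: eq_integral => x _.
  rewrite [in LHS](fimfunE (hn n)) !fsbig_finite//= sumEFin.
  by rewrite mulr_suml.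
rewrite ge0_integral_fsum//; last first.
- move=> r x _; rewrite lee_fin mulr_ge0//.
  have : (0 <= (r * \1_((hn n : Omega -> R) @^-1` [set r]) x)%:E)%E := nnfun_muleindic_ge0 (hn n) r x.
  by rewrite lee_fin.
- move=> r; apply/measurable_EFinP/measurable_funTS.
  by do 2 apply: measurable_funM => //; exact: measurable_indic.
apply: eq_fsbigr => r /set_mem [x0 _ hr].
have r0 : 0 <= r by rewrite -hr.
under eq_integral do rewrite -mulrA EFinM.
rewrite ge0_integralZl//; last 2 first.
- apply/measurable_EFinP/measurable_funTS.
  by apply: measurable_funM => //; exact: measurable_indic.
- by move=> x _; rewrite lee_fin mulr_ge0.
congr (_ * _)%E.
rewrite integral_mkcondr; apply: eq_integral => x _.
rewrite patchE indicE.
have [hx|hx] := pselect (((hn n : Omega -> R) @^-1` [set r]) x).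
  by rewrite !(mem_set hx) mul1r.
by rewrite !(memNset hx) mul0r.
Qed.

(** Two measures are allowed because this serves twice: for the change of measure from [P] to [Q],
    and to exchange an indicator for its conditional probability. *)
Lemma integral_mul_eq (mu1 mu2 : {measure set Omega -> \bar R}) (f1 f2 h : Omega -> R) :
  measurable_fun setT f1 -> measurable_fun setT f2 ->
  (forall x, 0 <= f1 x) -> (forall x, 0 <= f2 x) ->
  (forall A, G A -> \int[mu1]_(x in A) (f1 x)%:E = \int[mu2]_(x in A) (f2 x)%:E)%E ->
  G_measurable G h -> (forall x, 0 <= h x) ->
  forall A, G A ->
  (\int[mu1]_(x in A) (h x * f1 x)%:E = \int[mu2]_(x in A) (h x * f2 x)%:E)%E.
Proof.
move=> mf1 mf2 f10 f20 f12 Gh h0 A GA.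
have mh : measurable_fun setT (EFin \o h : g_sigma_algebraType G -> \bar R).
  by apply/measurable_EFinP/G_measurableE.
rewrite !(integral_mul_limit mh)//.
congr (limn _); apply/funext => n; apply: eq_fsbigr => r _.
congr (_ * _)%E; apply: f12.
apply/sub_measurableP; apply: measurableI; first exact/sub_measurableP.
exact: measurable_sfunP.
Qed.



Lemma density_finite_measure (mu : {measure set Omega -> \bar R}) (f : Omega -> R) :
  measurable_fun setT f -> (forall x, 0 <= f x) ->
  (\int[mu]_x (f x)%:E < +oo)%E ->
  exists nu : {finite_measure set Omega -> \bar R},
    forall A, nu A = (\int[mu]_(x in A) (f x)%:E)%E.
Proof.
move=> mf f0 fy.
pose k A := (\int[mu]_(x in A) (f x)%:E)%E.
have k0 : k set0 = 0%E by rewrite /k integral_set0.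
have kge0 A : (0 <= k A)%E by apply: integral_ge0 => x _; rewrite lee_fin.
have ksigma : semi_sigma_additive k.
  move=> F mF tF mUF; rewrite /k; apply: cvg_toP.
    apply: ereal_nondecreasing_is_cvgn => m n mn.
    by apply: lee_sum_nneg_natr => // i _ _; exact: kge0.
  rewrite ge0_integral_bigcup//=.
  - by apply/measurable_EFinP; exact: measurable_funTS.
  - by move=> x _; rewrite lee_fin.
pose km : {measure set Omega -> \bar R} :=
  HB.pack k (isMeasure.Build _ _ _ k k0 kge0 ksigma).
have kfin : fin_num_fun km.
  move=> A mA; rewrite ge0_fin_numE//; apply: le_lt_trans fy.
  apply: ge0_subset_integral => //; first exact/measurable_EFinP.
  by move=> x _; rewrite lee_fin.
pose kf : {finite_measure set Omega -> \bar R} := HB.pack k km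
  (Measure_isFinite.Build _ _ _ km kfin).
by exists kf.
Qed.

(** Radon-Nikodym is to be applied on the space carrying [G], which is what makes the derivative
    [G]-measurable. *)
Lemma restricted_finite_measure (mu : {finite_measure set Omega -> \bar R}) :
  exists nu : {finite_measure set (g_sigma_algebraType G) -> \bar R},
    nu = pushforward mu (id : Omega -> g_sigma_algebraType G) :> (_ -> _).
Proof.
pose k (A : set (g_sigma_algebraType G)) := mu (A : set Omega).
have k0 : k set0 = 0%E by exact: measure0.
have kge0 A : (0 <= k A)%E by exact: (measure_ge0 mu).
have ksigma : semi_sigma_additive k.
  move=> F mF tF mUF.
  have mF' i : measurable (F i : set Omega).
    by apply: Gm; apply: (proj1 (sub_measurableP _)); exact: mF.
  have mU' : measurable (\bigcup_n F n : set Omega).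
    by apply: Gm; exact: (proj1 (sub_measurableP _)) mUF.
  exact: (@measure_semi_sigma_additive _ _ _ mu F mF' tF mU').
pose km : {measure set (g_sigma_algebraType G) -> \bar R} :=
  HB.pack k (isMeasure.Build _ _ _ k k0 kge0 ksigma).
have kfin : fin_num_fun km.
  by move=> A /sub_measurableP GA; apply: fin_num_measure; exact: Gm.
pose kf : {finite_measure set (g_sigma_algebraType G) -> \bar R} := HB.pack k km
  (Measure_isFinite.Build _ _ _ km kfin).
by exists kf.
Qed.

Lemma nonneg_cond_exp (Q : probability Omega R) (X : Omega -> R) :
  measurable_fun setT X -> (forall x, 0 <= X x) ->
  (\int[Q]_x (X x)%:E < +oo)%E ->
  exists Y : Omega -> R, [/\ G_measurable G Y, (forall x, 0 <= Y x) &
    forall A, G A -> (\int[Q]_(x in A) (X x)%:E = \int[Q]_(x in A) (Y x)%:E)%E].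
Proof.
move=> mX X0 Xy.
have [nuX nuXE] := density_finite_measure (mu := Q) mX X0 Xy.
have [nu nuE] := restricted_finite_measure nuX.
have [m mE] := restricted_finite_measure Q.
have mid : measurable_fun setT (id : Omega -> g_sigma_algebraType G).
  by move=> _ B mB; rewrite setTI; apply: Gm; exact/sub_measurableP.
have num : nu `<< m.
  apply/null_content_dominatesP => A mA.
  move=> mA0; have QA : Q A = 0%E.
    by transitivity (m A); [rewrite mE|exact: mA0].
  transitivity (nuX A); first by rewrite nuE.
  rewrite nuXE.
  apply: null_set_integral => //; first by apply: Gm; exact/sub_measurableP.
  by apply/measurable_EFinP; exact: measurable_funTS.
have [f [f0 ffin fint fE]] := radon_nikodym_sigma_finite num.
have mf : measurable_fun setT f by exact: measurable_int fint.
have GY : G_measurable G (fine \o f).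
  by apply/G_measurableE; apply: measurableT_comp.
exists (fine \o f); split => //; first by move=> x; exact: fine_ge0.
move=> A GA; have mA : measurable (A : set (g_sigma_algebraType G)).
  exact/sub_measurableP.
rewrite -nuXE.
transitivity (\int[pushforward Q (id : Omega -> g_sigma_algebraType G)]_(x in A) f x)%E.
  by rewrite -mE; have := fE _ mA; rewrite nuE.
rewrite (ge0_integral_pushforward mid)//.
  by apply: eq_integral => x _ /=; rewrite fineK.
exact: measurable_funTS.
Qed.

End SubSigmaAlgebra.

(** * From a density to a consistent price system *)

Section Probability.
Context {d : measure_display} {Omega : measurableType d} {R : realType}.

Lemma pos_integral_eq0 (mu : {measure set Omega -> \bar R}) (B : set Omega) (f : Omega -> R) :
  measurable B -> measurable_fun setT f -> (forall x, B x -> 0 < f x) ->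
  (\int[mu]_(x in B) (f x)%:E <= 0)%E -> mu B = 0%E.
Proof.
move=> mB mf f0 fle0.
have : (\int[mu]_(x in B) `|(f x)%:E| = 0)%E.
  apply/eqP; rewrite eq_le integral_ge0// andbT.
  rewrite (eq_integral (fun x => (f x)%:E))// => x /set_mem Bx.
  by rewrite gee0_abs// lee_fin ltW// f0.
move/ae_eq_integral_abs => /(_ mB) H.
have [|N [mN N0 BN]] := H; first by apply/measurable_EFinP; exact: measurable_funTS.
apply: (subset_measure0 mB mN _ N0) => x Bx; apply: BN => /= /(_ Bx) [fx0].
by have := f0 x Bx; rewrite fx0 ltxx.
Qed.

(** After subtraction a strictly positive function has integral at most 0 over [B]; finiteness of
    the integral of [g] permits the subtraction. Each exceptional set of the price is shown null in
    this way. *)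
Lemma null_of_integral_le (mu : {measure set Omega -> \bar R}) (B : set Omega)
    (f g : Omega -> R) :
  measurable B -> measurable_fun setT f -> measurable_fun setT g ->
  (forall x, 0 <= g x) -> (forall x, B x -> g x < f x) ->
  (\int[mu]_(x in B) (f x)%:E <= \int[mu]_(x in B) (g x)%:E)%E ->
  (\int[mu]_(x in B) (g x)%:E < +oo)%E -> mu B = 0%E.
Proof.
move=> mB mf mg g0 gf fg gy.
apply: (@pos_integral_eq0 mu B (fun x => f x - g x)) => //.
- exact: measurable_funB.
- by move=> x Bx; rewrite subr_gt0 gf.
have gfin : (\int[mu]_(x in B) (g x)%:E \is a fin_num)%E.
  by rewrite ge0_fin_numE// integral_ge0// => x _; rewrite lee_fin.
rewrite -(leeD2rE _ _ gfin) add0e -ge0_integralD//.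
- rewrite [X in (X <= _)%E](_ : _ = \int[mu]_(x in B) (f x)%:E)%E//.
  by apply: eq_integral => x _; rewrite -EFinD subrK.
- by move=> x Bx; rewrite lee_fin subr_ge0 ltW// gf.
- by apply/measurable_EFinP/measurable_funTS/measurable_funB.
- by move=> x _; rewrite lee_fin.
- exact/measurable_EFinP/measurable_funTS.
Qed.

Lemma density_probability (P : probability Omega R) (f : Omega -> R) :
  measurable_fun setT f -> (forall x, 0 <= f x) ->
  (\int[P]_x (f x)%:E = 1)%E ->
  exists Q : probability Omega R,
    forall A, Q A = (\int[P]_(x in A) (f x)%:E)%E.
Proof.
move=> mf f0 f1.
have [|nu nuE] := density_finite_measure (mu := P) mf f0; first by rewrite f1 ltry.
have nu1 : nu setT = 1%E by rewrite nuE.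
pose Q : probability Omega R :=
  HB.pack (nu : set Omega -> \bar R) nu (Measure_isProbability.Build _ _ _ nu nu1).
by exists Q.
Qed.

End Probability.

Lemma null_bigcup_ord {d : measure_display} {T : measurableType d} {R : realType}
    (mu : {measure set T -> \bar R}) n (B : 'I_n -> set T) :
  (forall i, measurable (B i)) -> (forall i, mu (B i) = 0%E) ->
  mu (\bigcup_i B i) = 0%E.
Proof.
move=> mB B0; apply: measure_negligible.
  by apply: fin_bigcup_measurable; first exact: finite_finset.
apply: (@negligibleS _ _ _ _ (\bigcup_k (if insub k is Some i then B i else set0))).
  by move=> x [i _ Bx]; exists i => //; rewrite valK.
apply: negligible_bigcup => k; case: insubP => [i _ _|_]; last exact: negligible_set0.
exact: (proj2 (negligibleP mu (mB i)) (B0 i)).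
Qed.

Section ConsistentPrice.
Context {d : measure_display} {Omega : measurableType d} {R : realType}.
Variables (P : probability Omega R) (T : R) (F : R -> set (set Omega)).
Variables (n : nat) (delta : R) (S : R -> Omega -> 'I_n -> R).
Hypothesis T0 : 0 < T.
Hypothesis sF : forall t, in_time T t -> sigma_algebra setT (F t).
Hypothesis Fm : forall t, in_time T t -> F t `<=` measurable.
Hypothesis Fle : forall s t, 0 <= s -> s <= t -> t <= T -> F s `<=` F t.
Hypothesis delta01 : 0 < delta < 1.
Hypothesis S_adapted : forall t i, in_time T t -> G_measurable (F t) (fun w => S t w i).
Hypothesis S_O : forall w t, in_time T t -> Oset delta (S t w).

Lemma OsetP (x : 'I_n -> R) : (forall i, 0 < x i) -> (0 < n)%N ->
  Oset delta x <-> forall j, x j < (1 - delta) * \sum_(i < n) x i.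
Proof.
move=> x0 n0.
have s0 : 0 < \sum_(i < n) x i.
  rewrite (bigD1 (Ordinal n0))//= ltr_pwDl// sumr_ge0// => i _.
  exact: ltW.
have d1 : 0 < 1 - delta by case/andP: delta01 => _; rewrite subr_gt0.
split=> [[_ /bigmax_ltP[_ +]] j|H].
  by move=> /(_ j isT); rewrite ltr_pdivrMr.
by split=> //; apply/bigmax_ltP; split => // j _; rewrite ltr_pdivrMr.
Qed.

Variable e : R.
Hypothesis e0 : 0 < e.
Variable Z : Omega -> R.
Hypothesis mZ : measurable_fun setT Z.
Hypothesis Z0 : forall w, 0 < Z w.
Hypothesis Zint : (\int[P]_w (Z w)%:E < +oo)%E.
Hypothesis ZSint : forall i, (\int[P]_w (Z w * S T w i)%:E < +oo)%E.
Hypothesis Zle : forall t i A, in_time T t -> F t A ->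
  (\int[P]_(w in A) (Z w * S t w i)%:E
    <= (1 + e)%:E * \int[P]_(w in A) (Z w * S T w i)%:E)%E.
Hypothesis Zge : forall t i A, in_time T t -> F t A ->
  (\int[P]_(w in A) (Z w * S T w i)%:E
    <= (1 + e)%:E * \int[P]_(w in A) (Z w * S t w i)%:E)%E.

(** [Q] has density [Z] normalized to mass 1, and the price at t is the [Q]-conditional expectation
    of [S T]. Bounds integrated over sets of [F t] are all that a conditional expectation can see.
    Since the martingale property compares fixed times, the price may be corrected on a null set
    separately for each t, so that the bounds hold at every w and t. *)
Lemma eps_CPS_of_density : (0 < n)%N -> exists St Q, eps_CPS T e P F S St Q /\
  (forall w t, in_time T t -> Oset delta (St t w)).
Proof.
move=> n0.
have tT : in_time T T by rewrite /in_time (ltW T0) lexx.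
have mS t i : in_time T t -> measurable_fun setT (fun w => S t w i).
  by move=> tt; apply: (G_measurable_measurable (Fm tt)); exact: S_adapted.
have S0 t i w : in_time T t -> 0 < S t w i by move=> /S_O => /(_ w)[].
have Z0' w : 0 <= Z w by exact: ltW.
have d1 : 0 < 1 - delta by case/andP: delta01 => _; rewrite subr_gt0.
have e1 : 0 < 1 + e by rewrite addr_gt0.
pose c := fine (\int[P]_w (Z w)%:E).
have cfin : ((\int[P]_w (Z w)%:E) \is a fin_num)%E.
  by rewrite ge0_fin_numE// integral_ge0// => w _; rewrite lee_fin.
have c0 : 0 < c.
  rewrite lt_neqAle fine_ge0 ?andbT; last by apply: integral_ge0 => w _; rewrite lee_fin.
  apply/eqP => c0.
  have : P setT = 0%E.
    apply: (@pos_integral_eq0 _ _ _ P setT Z) => //.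
    by rewrite -(fineK cfin) -/c -c0.
  by rewrite probability_setT => -[] /eqP; rewrite oner_eq0.
have cV0 : 0 <= c^-1 by rewrite invr_ge0 ltW.
pose f w := c^-1 * Z w.
have mf : measurable_fun setT f by apply: measurable_funM.
have f0 w : 0 <= f w by rewrite mulr_ge0.
have [|Q QE] := density_probability (P := P) mf f0.
  under eq_integral do rewrite EFinM.
  rewrite ge0_integralZl//; last 2 first.
  - exact/measurable_EFinP.
  - by move=> w _; rewrite lee_fin.
  by rewrite -(fineK cfin) -EFinM mulVf// gt_eqF.
(* Change of measure: [integral_mul_eq] over all measurable sets, with the constant 1 against [Q]
   and [f] against [P]. *)
have Qint (h : Omega -> R) A : measurable_fun setT h -> (forall w, 0 <= h w) ->
    measurable A ->
    (\int[Q]_(w in A) (h w)%:E = c^-1%:E * \int[P]_(w in A) (Z w * h w)%:E)%E.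
  move=> mh h0 mA.
  have := @integral_mul_eq d Omega R measurable (@sigma_algebra_measurable _ Omega)
    (@subset_refl _ _) Q P (cst 1) f h.
  move=> /(_ (measurable_cst _) mf (fun=> ler01) f0) H.
  under eq_integral do rewrite -[h _]mulr1.
  rewrite H//; last 2 first.
  - move=> B mB; transitivity (1 * Q B)%E; first exact: (integral_cst Q mB 1%E).
    by rewrite mul1e QE.
  - by move=> B mB; rewrite -[X in measurable X]setTI; exact: mh.
  under eq_integral do rewrite /f mulrCA (mulrC (h _)) EFinM.
  rewrite ge0_integralZl//.
  - by apply/measurable_EFinP/measurable_funTS/measurable_funM.
  - by move=> w _; rewrite lee_fin mulr_ge0.
have QP : equiv_prob P Q.
  move=> A mA; split=> [PA|].
    rewrite QE; apply: null_set_integral => //.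
    by apply/measurable_EFinP/measurable_funTS.
  rewrite QE => fA; apply: (@pos_integral_eq0 _ _ _ P A f) => //; last by rewrite fA.
  by move=> w _; rewrite mulr_gt0// invr_gt0.
have QS t i A : in_time T t -> measurable A ->
    (\int[Q]_(w in A) (S t w i)%:E = c^-1%:E * \int[P]_(w in A) (Z w * S t w i)%:E)%E.
  by move=> tt mA; apply: Qint => //; [exact: mS|move=> w; exact/ltW/S0].
have QSle t i A : in_time T t -> F t A ->
    (\int[Q]_(w in A) (S t w i)%:E <= (1 + e)%:E * \int[Q]_(w in A) (S T w i)%:E)%E.
  move=> tt FA; have mA := Fm tt FA.
  by rewrite !QS// muleCA lee_wpmul2l ?lee_fin// Zle.
have QSge t i A : in_time T t -> F t A ->
    (\int[Q]_(w in A) (S T w i)%:E <= (1 + e)%:E * \int[Q]_(w in A) (S t w i)%:E)%E.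
  move=> tt FA; have mA := Fm tt FA.
  by rewrite !QS// muleCA lee_wpmul2l ?lee_fin// Zge.
have QSTy i : (\int[Q]_w (S T w i)%:E < +oo)%E.
  by rewrite QS// lte_mul_pinfty ?lee_fin.
have HY (ti : R * 'I_n) : exists Y : Omega -> R, in_time T ti.1 ->
    [/\ G_measurable (F ti.1) Y, (forall w, 0 <= Y w) &
      forall A, F ti.1 A -> (\int[Q]_(w in A) (S T w ti.2)%:E = \int[Q]_(w in A) (Y w)%:E)%E].
  have [tt|] := pselect (in_time T ti.1); last by exists (cst 0).
  have [Y ?] := nonneg_cond_exp (sF tt) (Fm tt) (mS T ti.2 tT)
    (fun w => ltW (S0 T ti.2 w tT)) (QSTy ti.2).
  by exists Y.
have {HY} [Y0 HY] := choice HY.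
pose Y t w i := Y0 (t, i) w.
have YG t i : in_time T t -> G_measurable (F t) (fun w => Y t w i).
  by move=> tt; have [] := HY (t, i) tt.
have Yge0 t w i : in_time T t -> 0 <= Y t w i.
  by move=> tt; have [_ + _] := HY (t, i) tt; exact.
have YE t i A : in_time T t -> F t A ->
    (\int[Q]_(w in A) (S T w i)%:E = \int[Q]_(w in A) (Y t w i)%:E)%E.
  by move=> tt FA; have [_ _] := HY (t, i) tt; exact.
have mY t i : in_time T t -> measurable_fun setT (fun w => Y t w i).
  by move=> tt; apply: (G_measurable_measurable (Fm tt)); exact: YG.
have QSTAy i A : measurable A -> (\int[Q]_(w in A) (S T w i)%:E < +oo)%E.
  move=> mA; apply: le_lt_trans (QSTy i); apply: ge0_subset_integral => //.
    by apply/measurable_EFinP/mS.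
  by move=> w _; rewrite lee_fin; exact/ltW/S0.
have eY t i A : in_time T t -> measurable A ->
    (\int[Q]_(w in A) ((1 + e) * Y t w i)%:E =
      (1 + e)%:E * \int[Q]_(w in A) (Y t w i)%:E)%E.
  move=> tt mA; under eq_integral do rewrite EFinM.
  rewrite ge0_integralZl// ?lee_fin ?(ltW e1)//.
    by apply/measurable_EFinP/measurable_funTS/mY.
  by move=> w _; rewrite lee_fin Yge0.
have eS t i A : in_time T t -> measurable A ->
    (\int[Q]_(w in A) ((1 + e) * S t w i)%:E =
      (1 + e)%:E * \int[Q]_(w in A) (S t w i)%:E)%E.
  move=> tt mA; under eq_integral do rewrite EFinM.
  rewrite ge0_integralZl// ?lee_fin ?(ltW e1)//.
    by apply/measurable_EFinP/measurable_funTS/mS.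
  by move=> w _; rewrite lee_fin ltW ?S0.
(* Y t satisfies the bounds only almost surely; on the F t-measurable null set
   bad t it is replaced by S t. Membership in Oset, which is convex, is the
   linear condition excluded by bad3. *)
pose bad1 t i := [set w | (1 + e) * Y t w i < S t w i].
pose bad2 t i := [set w | (1 + e) * S t w i < Y t w i].
pose bad3 t j := [set w | (1 - delta) * (\sum_(i < n) Y t w i) <= Y t w j].
pose bad t := \bigcup_(i in [set: 'I_n]) (bad1 t i `|` bad2 t i `|` bad3 t i).
have GY t i (tt : in_time T t) := (G_measurableE (sF tt) _).1 (YG t i tt).
have GS t i (tt : in_time T t) := (G_measurableE (sF tt) _).1 (S_adapted i tt).
have mlt t (f1 f2 : Omega -> R) (tt : in_time T t) :
    measurable_fun setT (f1 : g_sigma_algebraType (F t) -> R) ->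
    measurable_fun setT (f2 : g_sigma_algebraType (F t) -> R) ->
    F t [set w | f1 w < f2 w].
  move=> m1 m2; apply/(sub_measurableP (sF tt)).
  have := measurable_fun_ltr m1 m2 => /(_ measurableT [set true]).
  by rewrite setTI; apply.
have mle t (f1 f2 : Omega -> R) (tt : in_time T t) :
    measurable_fun setT (f1 : g_sigma_algebraType (F t) -> R) ->
    measurable_fun setT (f2 : g_sigma_algebraType (F t) -> R) ->
    F t [set w | f1 w <= f2 w].
  move=> m1 m2; apply/(sub_measurableP (sF tt)).
  have := measurable_fun_ler m1 m2 => /(_ measurableT [set true]).
  by rewrite setTI; apply.
have Fb1 t i : in_time T t -> F t (bad1 t i).
  by move=> tt; apply: mlt => //; [apply: measurable_funM => //; exact: GY|exact: GS].
have Fb2 t i : in_time T t -> F t (bad2 t i).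
  by move=> tt; apply: mlt => //; [apply: measurable_funM => //; exact: GS|exact: GY].
have Fb3 t i : in_time T t -> F t (bad3 t i).
  move=> tt; apply: mle => //; last exact: GY.
  by apply: measurable_funM => //; apply: measurable_sum => j; exact: GY.
have Fbad t : in_time T t -> F t (bad t).
  move=> tt; apply/(sub_measurableP (sF tt)).
  apply: fin_bigcup_measurable; first exact: finite_finset.
  by move=> i _; apply: measurableU; [apply: measurableU|]; apply/(sub_measurableP (sF tt));
    [exact: Fb1|exact: Fb2|exact: Fb3].
have Qbad t : in_time T t -> Q (bad t) = 0%E.
  move=> tt; apply: null_bigcup_ord => i.
    apply: measurableU; last exact: Fm (Fb3 t i tt).
    by apply: measurableU; [exact: Fm (Fb1 t i tt)|exact: Fm (Fb2 t i tt)].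
  have m1 := Fm tt (Fb1 t i tt); have m2 := Fm tt (Fb2 t i tt).
  have m3 := Fm tt (Fb3 t i tt).
  apply: null_set_setU => //; first exact: measurableU.
    apply: null_set_setU => //.
      apply: (@null_of_integral_le _ _ _ Q _ (fun w => S t w i)
        (fun w => (1 + e) * Y t w i)) => //.
      - exact: mS.
      - by apply: measurable_funM => //; exact: mY.
      - by move=> w; rewrite mulr_ge0 ?(ltW e1) ?Yge0.
      - by rewrite eY// -YE ?QSle//; exact: Fb1.
      - by rewrite eY// -YE ?lte_mul_pinfty ?lee_fin ?(ltW e1) ?QSTAy//; exact: Fb1.
    apply: (@null_of_integral_le _ _ _ Q _ (fun w => Y t w i)
        (fun w => (1 + e) * S t w i)) => //.
    - exact: mY.
    - by apply: measurable_funM => //; exact: mS.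
    - by move=> w; rewrite mulr_ge0 ?(ltW e1) ?(ltW (S0 _ _ _ tt)).
    - rewrite -YE//; last exact: Fb2.
      by rewrite eS// QSge//; exact: Fb2.
    - rewrite eS//; apply: (@le_lt_trans _ _ ((1 + e)%:E * ((1 + e)%:E *
        \int[Q]_(w in bad2 t i) (S T w i)%:E))%E).
        by rewrite lee_wpmul2l ?lee_fin ?(ltW e1) ?QSle//; exact: Fb2.
      by rewrite !lte_mul_pinfty ?lee_fin ?(ltW e1)// QSTAy.
  have sumE (V : Omega -> 'I_n -> R) : (forall j, measurable_fun setT (V^~ j)) ->
      (forall w j, 0 <= V w j) ->
      (\int[Q]_(w in bad3 t i) ((1 - delta) * \sum_(j < n) V w j)%:E =
       (1 - delta)%:E * \sum_(j < n) \int[Q]_(w in bad3 t i) (V w j)%:E)%E.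
    move=> mV V0.
    under eq_integral do rewrite EFinM -sumEFin.
    rewrite ge0_integralZl//.
    - rewrite ge0_integral_sum//.
        by move=> j; apply/measurable_EFinP/measurable_funTS.
      by move=> j w _; rewrite lee_fin.
    - by apply: emeasurable_sum => j; apply/measurable_EFinP/measurable_funTS.
    - by move=> w _; apply: sume_ge0 => j _; rewrite lee_fin.
    - by rewrite lee_fin ltW.
  (* Over [bad3 t i], a set of [F t], [Y t] and [S T] have equal integrals, so the inequality
     defining the set passes to the integrals of [S T], which satisfies the strict opposite at every
     point because it lies in O. *)
  apply: (@null_of_integral_le _ _ _ Q _ (fun w => (1 - delta) * \sum_(j < n) S T w j)
        (fun w => S T w i)) => //.
  - by apply: measurable_funM => //; apply: measurable_sum => j; exact: mS.
  - exact: mS.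
  - by move=> w; exact/ltW/S0.
  - by move=> w _; apply: (OsetP _ n0).1; [move=> j; exact: S0|exact: S_O].
  - rewrite sumE; [|by move=> j; exact: mS|by move=> w j; exact/ltW/S0].
    under eq_bigr do rewrite (YE t _ _ tt (Fb3 _ _ tt)).
    rewrite -sumE; [|by move=> j; exact: mY|by move=> w j; exact: Yge0].
    rewrite (YE t _ _ tt (Fb3 _ _ tt)).
    apply: ge0_le_integral => //.
    - by move=> w _; rewrite lee_fin mulr_ge0 ?(ltW d1) ?sumr_ge0// => j _; exact: Yge0.
    - apply/measurable_EFinP/measurable_funTS/measurable_funM => //.
      by apply: measurable_sum => j; exact: mY.
    - by apply/measurable_EFinP/measurable_funTS/mY.
  - exact: QSTAy.
pose St t w i := if w \in bad t then S t w i else Y t w i.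
have StG t i : in_time T t -> G_measurable (F t) (fun w => St t w i).
  move=> tt; apply/(G_measurableE (sF tt)); rewrite /St.
  apply: measurable_fun_ifT; [|exact: GS|exact: GY].
  apply: (measurable_fun_bool true) => /=.
  rewrite setTI preimage_mem_true.
  by apply/(sub_measurableP (sF tt)); exact: Fbad.
have StE t i A : in_time T t -> measurable A ->
    (\int[Q]_(w in A) (St t w i)%:E = \int[Q]_(w in A) (Y t w i)%:E)%E.
  move=> tt mA; apply: ae_eq_integral => //.
  - by apply/measurable_EFinP/measurable_funTS/(G_measurable_measurable (Fm tt))/StG.
  - by apply/measurable_EFinP/measurable_funTS/mY.
  exists (bad t); split; [exact: Fm (Fbad t tt)|exact: Qbad|].
  move=> w; apply: contra_notP => /= nb _; rewrite /St.
  by case: ifPn => // /set_mem.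
have good t w i : in_time T t -> [/\ S t w i <= (1 + e) * St t w i, 
   St t w i <= (1 + e) * S t w i & St t w i < (1 - delta) * \sum_(j < n) St t w j].
  move=> tt; rewrite /St; case: ifPn => [_|].
    have Sp := S0 t i w tt.
    have le1 : S t w i <= (1 + e) * S t w i by rewrite ler_peMl ?ltW// ltrDl.
    split => //; apply: (OsetP _ n0).1; first by move=> j; exact: S0.
    exact: S_O.
  rewrite notin_setE => /= nbad.
  split.
  - by rewrite leNgt; apply/negP => h; apply: nbad; exists i => //; left; left.
  - by rewrite leNgt; apply/negP => h; apply: nbad; exists i => //; left; right.
  - by rewrite ltNge; apply/negP => h; apply: nbad; exists i => //; right.
have Stpos t w i : in_time T t -> 0 < St t w i.
  move=> tt; have [+ _ _] := good t w i tt.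
  by move=> /(lt_le_trans (S0 t i w tt)); rewrite pmulr_rgt0.
have Stint t i : in_time T t -> Q.-integrable setT (EFin \o (fun w => St t w i)).
  move=> tt; apply/integrableP; split.
    by apply/measurable_EFinP/(G_measurable_measurable (Fm tt))/StG.
  under eq_integral do rewrite /= ger0_norm ?(ltW (Stpos _ _ _ tt))//.
  rewrite StE// -YE//.
  by have := sigma_algebra_id (sF tt); case: (sF tt) => F00 FC _ _; rewrite -(setC0); rewrite -setTD; exact: FC.
exists St, Q; split; last first.
  move=> w t tt; apply/OsetP => //; first by move=> i; exact: Stpos.
  by move=> j; have [] := good t w j tt.
split => //.
- move=> s t i s0 st tT'.
  have tt : in_time T t by rewrite /in_time (le_trans s0 st).
  have ss : in_time T s by rewrite /in_time s0 (le_trans st).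
  split; [|exact: Stint|exact: StG|exact: Stint|].
    by apply: (G_measurable_measurable (Fm tt)); exact: StG.
  move=> A FA; have FtA := Fle s0 st tT' FA.
  have mA := Fm ss FA; rewrite (StE t)// (StE s)//.
  by rewrite -(YE t)// -(YE s)//.
- apply: aeW => w t i tt; have [h1 h2 _] := good t w i tt.
  rewrite ler_pdivrMr ?S0// h2 andbT ler_pdivlMr ?S0//.
  by rewrite -ler_pdivlMl ?invr_gt0// invrK.
Qed.

End ConsistentPrice.

(** * Variation of a path along rational chains *)

Section ChainCost.
Context {R : realType}.
Variable c : R -> R -> R.

Fixpoint chain_cost (x : R) (l : seq R) : R :=
  if l is y :: l' then c x y + chain_cost y l' else 0.

Lemma chain_cost_rcons x l y :
  chain_cost x (rcons l y) = chain_cost x l + c (last x l) y.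
Proof. by elim: l x => [|z l IH] x /=; rewrite ?add0r ?addr0// IH addrA. Qed.

(* Splitting the chain at time t, only the step that straddles t costs more
   than in the chain stopped at t, and by at most K. *)
Lemma chain_cost_freeze (t T K : R) x l : 0 <= K ->
  (forall a b, 0 <= c a b) ->
  (forall a b, a <= t -> t <= b -> b <= T -> c a b <= c a t + K) ->
  (forall a b, t <= a -> a <= b -> b <= T -> c a b = 0) ->
  x <= t -> path <=%R x l -> all (fun y => y <= T) l ->
  chain_cost x l <= chain_cost x (rcons [seq y <- l | y <= t] t) + K.
Proof.
move=> K0 c0 cK cz; elim: l x => [|y l IH] x xt /=.
  by move=> _ _; rewrite addr0 addr_ge0.
move=> /andP[xy pyl] /andP[yT lT].
case: ifPn => [yt|].
  by rewrite /= -addrA lerD2l; exact: IH.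
rewrite -ltNge => ty.
have -> : [seq y0 <- l | y0 <= t] = [::].
  apply/eqP; rewrite -(negbK (_ == _)) -has_filter; apply/hasPn => z zl.
  rewrite -ltNge (lt_le_trans ty)//.
  by have /allP := order_path_min le_trans pyl; apply.
have -> : chain_cost y l = 0.
  have : t <= y by exact: ltW.
  elim: l y {IH xy ty} yT pyl lT => [//|z l IH] y yT /=.
  move=> /andP[yz pzl] /andP[zT lT] ty.
  by rewrite cz// add0r IH// (le_trans ty).
by rewrite /= !addr0 cK// ltW.
Qed.

Lemma chain_cost_le (C T : R) x l :
  (forall a b, 0 <= a -> a <= b -> b <= T -> c a b <= C * (b - a)) ->
  0 <= x -> path <=%R x l -> all (fun y => y <= T) l ->
  chain_cost x l <= C * (last x l - x).
Proof.
move=> cC; elim: l x => [|y l IH] x x0 /=; first by rewrite subrr mulr0.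
move=> /andP[xy pyl] /andP[yT lT].
have -> : C * (last y l - x) = C * (y - x) + C * (last y l - y) by ring.
by apply: lerD; [exact: cC|exact: IH (le_trans x0 xy) _ _].
Qed.

End ChainCost.

(** * Suprema of countable families *)

Section CountableSup.

(** A real supremum, so every use has to exhibit a bound; countability of the index preserves
    measurability. *)
Definition csup {I : countType} {R : realType} (f : I -> R) : R := sup (range f).

Lemma csup_ge {I : countType} {R : realType} (f : I -> R) (B : R) i :
  (forall j, f j <= B) -> f i <= csup f.
Proof.
move=> fB; apply: ub_le_sup; last by exists i.
by exists B => _ [j _ <-].
Qed.

Lemma csup_le {I : countType} {R : realType} (f : I -> R) (B : R) (i0 : I) :
  (forall j, f j <= B) -> csup f <= B.
Proof.
move=> fB; apply: ge_sup; first by exists (f i0), i0.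
by move=> _ [j _ <-].
Qed.

Lemma measurable_csup {d} {T : measurableType d} {I : countType} {R : realType}
    (f : I -> T -> R) (i0 : I) :
  (forall i, measurable_fun setT (f i)) ->
  (forall x, exists B, forall i, f i x <= B) ->
  measurable_fun setT (fun x => csup (f ^~ x)).
Proof.
move=> mf fB; apply: (measurability _ (RGenOInfty.measurableE R)) => //.
move=> _ [_ [r ->] <-]; rewrite setTI.
rewrite [X in measurable X](_ : _ = \bigcup_i (f i @^-1` `]r, +oo[)).
  apply: countable_bigcupT_measurable => // i.
  by rewrite -[X in measurable X]setTI; apply: mf.
apply/seteqP; split => [x|x [i _]] /=.
  rewrite in_itv/= andbT => rx.
  have [_ [i _ <-] ri] : exists2 y, range (f^~ x) y & r < y.
    apply: sup_gt => //; first by exists (f i0 x), i0.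
  by exists i => //=; rewrite in_itv/= andbT.
rewrite /= !in_itv/= !andbT => /lt_le_trans; apply.
by have [B fxB] := fB x; apply: (@csup_ge _ _ (f^~ x) B).
Qed.

End CountableSup.

(** * Rates, costs of steps and their supremum over chains *)

Section Variation.
Context {R : realType}.
Variable T : R.

(** Scaling the rationals puts both 0 and [T] on the grid, whatever [T] is; chains have to be able
    to end at [T]. *)
Definition grid (q : rat) : R := T * ratr q.

(* The value 1 at excluded indices is harmless: rates are at least 1. *)
Definition running_sup (lam : R -> R) (t : R) : R :=
  csup (fun q : rat => if (0 <= q <= 1) && (grid q <= t) then lam (grid q) else 1).

(* The threshold 3 * rho makes every step free once the path is frozen
   within rho of some position. *)
Definition excess (rho x : R) : R := Num.max 0 (x - 3 * rho) / rho.

(** The rate is taken at the start of the step, so the unit price of leaving a position is known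
    before the move. *)
Definition step_cost (rho : R) (lam : R -> R) (dst : R -> R -> R) (a b : R) : R :=
  running_sup lam a * excess rho (dst a b).

(** Lists that are not chains in [0,t] get the cost 0 of the empty chain, so that the supremum can
    range over the whole countable type [seq rat]. *)
Definition grid_cost (c : R -> R -> R) (t : R) (l : seq rat) : R :=
  if path <=%R 0 (map grid l) && all (fun y => y <= t) (map grid l)
  then chain_cost c 0 (map grid l) else 0.

Definition variation (c : R -> R -> R) (t : R) : R := csup (grid_cost c t).

Lemma grid_leT q : 0 < T -> q <= 1 -> grid q <= T.
Proof. by move=> T0 q1; rewrite ler_piMr ?(ltW T0)// -(rmorph1 (ratr : rat -> R)) ler_rat. Qed.

Lemma excess_ge0 rho x : 0 < rho -> 0 <= excess rho x.
Proof. by move=> r0; rewrite divr_ge0 ?(ltW r0)// le_max lexx. Qed.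

Lemma excess_eq0 rho x : x <= 3 * rho -> excess rho x = 0.
Proof. by move=> xr; rewrite /excess max_l ?mul0r// subr_le0. Qed.

Lemma excess_le rho x y : 0 < rho -> x <= y + rho -> excess rho x <= excess rho y + 1.
Proof.
move=> r0 xy; rewrite /excess -[X in _ <= _ + X](divff (lt0r_neq0 r0)) -mulrDl.
rewrite ler_pM2r ?invr_gt0// ge_max; apply/andP; split.
  by rewrite addr_ge0 ?(ltW r0)// le_max lexx.
rewrite -lerBlDr le_max; apply/orP; right; lra.
Qed.

Lemma le_excess rho x : 0 < rho -> (x - 3 * rho) / rho <= excess rho x.
Proof. by move=> r0; rewrite ler_pM2r ?invr_gt0// le_max lexx orbT. Qed.

Variables (rho : R) (lam : R -> R) (dst : R -> R -> R) (B C : R).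
Hypothesis T0 : 0 < T.
Hypothesis rho0 : 0 < rho.
Hypothesis lam1 : forall t, 1 <= lam t.
Hypothesis lamB : forall q, 0 <= q <= 1 -> lam (grid q) <= B.
Hypothesis dst_sym : forall a b, dst a b = dst b a.
Hypothesis dst_tri : forall a b x, dst a b <= dst a x + dst x b.
Hypothesis dstC : forall a b, 0 <= a -> a <= b -> b <= T ->
  excess rho (dst a b) <= C * (b - a).

Let Lam := running_sup lam.
Let c := step_cost rho lam dst.

Let B1 : 1 <= B.
Proof. by apply: le_trans (lamB _ : lam (grid 0) <= B); rewrite ?lam1// lexx ler01. Qed.

Let LamB t q : (if (0 <= q <= 1) && (grid q <= t) then lam (grid q) else 1) <= B.
Proof. by case: ifPn => // /andP[q01 _]; exact: lamB. Qed.

Lemma running_sup_ge t q : 0 <= q <= 1 -> grid q <= t -> lam (grid q) <= Lam t.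
Proof.
move=> q01 qt; have := csup_ge q (LamB t).
by rewrite q01 qt.
Qed.

Lemma running_sup_ge1 t : 1 <= Lam t.
Proof. by have := csup_ge (-1 : rat) (LamB t). Qed.

Lemma running_sup_le s t : s <= t -> Lam s <= Lam t.
Proof.
move=> st; apply: (csup_le (0 : rat)) => q; case: ifPn => [/andP[q01 qs]|_].
  by apply: running_sup_ge => //; exact: le_trans st.
exact: running_sup_ge1.
Qed.

Lemma running_sup_leB t : Lam t <= B.
Proof. exact: (csup_le (0 : rat)). Qed.

Lemma step_cost_ge0 a b : 0 <= c a b.
Proof. by rewrite mulr_ge0 ?excess_ge0// (le_trans ler01 (running_sup_ge1 a)). Qed.

Let C0 : 0 <= C.
Proof.
have := dstC (lexx 0) (ltW T0) (lexx T).
by move=> /(le_trans (excess_ge0 _ rho0)); rewrite subr0 pmulr_lge0.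
Qed.

Lemma step_cost_le a b : 0 <= a -> a <= b -> b <= T -> c a b <= B * C * (b - a).
Proof.
move=> a0 ab bT; rewrite -mulrA ler_pM ?excess_ge0 ?running_sup_leB ?dstC//.
exact: le_trans ler01 (running_sup_ge1 a).
Qed.

(** Each step costs at most [B * C] times its duration and the durations add up to at most [T], so
    the bound does not depend on the number of steps. *)
Lemma grid_cost_le t l : t <= T -> grid_cost c t l <= B * C * T.
Proof.
have BC0 : 0 <= B * C by rewrite mulr_ge0// (le_trans ler01 B1).
move=> tT; rewrite /grid_cost; case: ifPn => [/andP[pl lt]|_]; last first.
  by rewrite mulr_ge0// ltW.
have lT : all (fun y => y <= T) (map grid l).
  by apply/allP => y /(allP lt) /le_trans; apply.
apply: le_trans (chain_cost_le step_cost_le (lexx 0) pl lT) _.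
rewrite ler_wpM2l// subr0; case: (lastP (map grid l)) lT => [_|s y].
  exact: ltW.
by rewrite last_rcons all_rcons => /andP[].
Qed.

Lemma grid_cost_variation t l : t <= T -> grid_cost c t l <= variation c t.
Proof. by move=> tT; apply: csup_ge => l'; exact: grid_cost_le. Qed.

Lemma variation_le t (K : R) : t <= T -> 0 <= K ->
  (forall l, path <=%R 0 (map grid l) -> all (fun y => y <= t) (map grid l) ->
    chain_cost c 0 (map grid l) <= K) -> variation c t <= K.
Proof.
move=> tT K0 H; apply: (csup_le [::]) => l; rewrite /grid_cost.
by case: ifPn => // /andP[pl lt]; exact: H.
Qed.

Lemma variation_ge0 t : t <= T -> 0 <= variation c t.
Proof. by move=> tT; have := grid_cost_variation [::] tT; rewrite /grid_cost /=. Qed.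

(** Any chain stopped at [grid q0] extends by [grid q0] and then [T]; the step into [grid q0] costs
    at least 0. *)
Lemma variation_step q0 : 0 <= q0 <= 1 ->
  variation c (grid q0) + c (grid q0) T <= variation c T.
Proof.
move=> /andP[q00 q01].
have g0 : 0 <= grid q0 by rewrite mulr_ge0 ?(ltW T0)// ler0q.
have gT : grid q0 <= T by exact: grid_leT.
have g1 : grid 1 = T by rewrite /grid rmorph1 mulr1.
have step l : path <=%R 0 (map grid l) -> all (fun y => y <= grid q0) (map grid l) ->
    chain_cost c 0 (map grid l) + c (grid q0) T <= variation c T.
  move=> pl lt.
  have := grid_cost_variation (rcons (rcons l q0) 1) (lexx T).
  rewrite /grid_cost !map_rcons !rcons_path !all_rcons !last_rcons pl g1 gT lexx/=.
  have -> : last 0 (map grid l) <= grid q0.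
    case: (lastP (map grid l)) lt => [//|s y].
    by rewrite last_rcons all_rcons => /andP[].
  have -> : all (fun y => y <= T) (map grid l).
    by apply/allP => y /(allP lt) /le_trans; apply.
  rewrite !chain_cost_rcons last_rcons; apply: le_trans.
  by rewrite lerD2r lerDl step_cost_ge0.
rewrite -lerBrDr; apply: variation_le => //.
  have := step [::] isT isT; rewrite /= add0r subr_ge0.
  by [].
by move=> l pl lt; rewrite lerBrDr; exact: step.
Qed.

(** Two positions after t are within [2 * rho] of each other, below the threshold, so later steps
    are free. The step straddling t may be ended at t instead: this changes its length by at most
    [rho], the unit in which [excess] is measured, hence its cost by at most one rate, and rates
    increase with time. *)
Lemma variation_freeze q0 : 0 <= q0 <= 1 ->
  (forall s, grid q0 <= s -> s <= T -> dst s (grid q0) <= rho) ->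
  variation c T <= variation c (grid q0) + Lam (grid q0).
Proof.
move=> /andP[q00 q01] fr; set t := grid q0.
have t0 : 0 <= t by rewrite mulr_ge0 ?(ltW T0)// ler0q.
have tT : t <= T by exact: grid_leT.
have L0 : 0 <= Lam t by exact: le_trans ler01 (running_sup_ge1 t).
apply: variation_le => //; first by rewrite addr_ge0 ?variation_ge0.
move=> l pl lT.
have := @chain_cost_freeze R c t T (Lam t) 0 (map grid l) L0 step_cost_ge0.
move=> /(_ _ _ t0 pl lT) H.
apply: le_trans (H _ _) _.
- move=> a b at_ tb bT; apply: (@le_trans _ _ (Lam a * (excess rho (dst a t) + 1))).
    rewrite ler_wpM2l ?(le_trans ler01 (running_sup_ge1 a))// excess_le//.
    by rewrite (le_trans (dst_tri a b t))// lerD2l dst_sym fr.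
  by rewrite mulrDr mulr1 lerD2l running_sup_le.
- move=> a b ta ab bT; rewrite /c /step_cost excess_eq0 ?mulr0//.
  have h1 := fr a ta (le_trans ab bT); have h2 := fr b (le_trans ta ab) bT.
  have h3 := dst_tri a b t; rewrite -/t (dst_sym t b) in h1 h2 h3.
  by have := rho0; lra.
rewrite lerD2r.
have := grid_cost_variation (rcons [seq q <- l | grid q <= t] q0) tT.
have E : map grid [seq q <- l | grid q <= t] = [seq y <- map grid l | y <= t].
  by rewrite filter_map.
rewrite /grid_cost map_rcons -/t E.
rewrite rcons_path all_rcons lexx/= filter_all andbT.
rewrite (path_filter le_trans _ pl)/=.
suff -> : last 0 [seq y <- map grid l | y <= t] <= t by [].
case: (lastP [seq y <- map grid l | y <= t]) (filter_all (fun y => y <= t) (map grid l)) => [//|s y].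
by rewrite last_rcons all_rcons => /andP[].
Qed.

End Variation.

(** * Paths and the logarithmic distance *)

Section PathMetric.
Context {R : realType}.
Variable T : R.

(** Compactness of [0,T] in near-covering form: a property valid near each point for all small k
    holds everywhere for a common k. *)
Lemma local_to_uniform (P : R -> R -> Prop) :
  (forall a, in_time T a -> exists2 h, 0 < h &
    forall k x, 0 < k -> k < h -> in_time T x -> `|a - x| < h -> P k x) ->
  exists2 k, 0 < k & forall x, in_time T x -> P k x.
Proof.
move=> HP; have cK := @segment_compact R 0 T.
have [|k [k0 Pk]] := @filter_ex _ (0:R)^'+ _ [set k | 0 < k /\ `[0, T]%classic `<=` P k].
  apply: filterI; first exact: nbhs_right_gt.
  move/compact_near_coveringP/near_covering_withinP : cK.
  move=> /(_ R (0:R)^'+ P _); apply => a /=.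
  rewrite in_itv /= => ta; have [h h0 Ph] := HP a ta.
  exists (ball a h, [set x | 0 < x /\ x < h]); first split => /=.
  - exact: nbhsx_ballx.
  - by apply: filterI; [exact: nbhs_right_gt|exact: nbhs_right_lt].
  move=> [x k] [/= ax [k0 kh]]; rewrite in_itv/= => tx.
  exact: Ph.
by exists k => // x tx; apply: Pk; rewrite /= in_itv.
Qed.

Variable dst : R -> R -> R.
Hypothesis T0 : 0 < T.
Hypothesis dst_ge0 : forall a b, 0 <= dst a b.
Hypothesis dst_sym : forall a b, dst a b = dst b a.
Hypothesis dst_tri : forall a b x, dst a b <= dst a x + dst x b.
Hypothesis dst_cont : forall a, in_time T a -> forall e, 0 < e ->
  exists2 h, 0 < h & forall b, in_time T b -> `|a - b| < h -> dst a b < e.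

Lemma dst_uniform e : 0 < e -> exists2 h, 0 < h &
  forall a b, in_time T a -> in_time T b -> `|a - b| < h -> dst a b < e.
Proof.
move=> e0; have e20 : 0 < e / 2 by rewrite divr_gt0.
have [|h h0 H] := @local_to_uniform
  (fun h a => forall b, in_time T b -> `|a - b| < h -> dst a b < e).
  move=> a ta; have [h h0 Hh] := dst_cont ta e20.
  have h20 : 0 < h / 2 by rewrite divr_gt0.
  exists (h / 2) => // k x k0 kh tx ax b tb xb.
  have := dst_tri x b a; rewrite (dst_sym x a).
  have : dst a x < e / 2.
    by apply: Hh => //; apply: lt_trans ax _; rewrite ltr_pdivrMr// ltr_pMr// ltr1n.
  have : dst a b < e / 2.
    apply: Hh => //; have -> : a - b = (a - x) + (x - b) by rewrite addrA subrK.
    apply: le_lt_trans (ler_normD _ _) _; rewrite [ltRHS](splitr h) ltrD//.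
    exact: lt_trans xb kh.
  lra.
by exists h => // a b ta; exact: H.
Qed.

Lemma dst_bounded : exists M, forall a b, in_time T a -> in_time T b -> dst a b <= M.
Proof.
(* Boundedness becomes a condition on small k by taking the bound to be 1/k. *)
have [|k k0 H] := @local_to_uniform (fun k x => dst 0 x <= k^-1).
  move=> a ta; have [h h0 Hh] := dst_cont ta ltr01.
  have p0 : 0 < dst 0 a + 1 by rewrite ltr_wpDl.
  exists (Num.min h (dst 0 a + 1)^-1); first by rewrite lt_min h0 invr_gt0.
  move=> k x k0; rewrite !lt_min => /andP[kh kd] tx /andP[ax _].
  apply: le_trans (dst_tri 0 x a) _.
  apply: (@le_trans _ _ (dst 0 a + 1)); first by rewrite lerD2l ltW// Hh.
  by rewrite -(invrK (dst 0 a + 1)) ler_pV2 ?ltW// inE unitfE ?k0 ?invr_gt0 ?p0 ?lt0r_neq0 ?invr_gt0.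
exists (k^-1 + k^-1) => a b ta tb; apply: le_trans (dst_tri a b 0) _.
by rewrite (dst_sym a) lerD// H.
Qed.

(** A strict inequality on the compact interval [u,T] holds with a uniform margin; openness of the
    set of frozen paths rests on it. *)
Lemma dst_margin u r : in_time T u -> (forall s, u <= s -> s <= T -> dst s u < r) ->
  exists2 k, 0 < k & forall s, u <= s -> s <= T -> dst s u + k < r.
Proof.
move=> /andP[u0 uT] Hr.
have [|k k0 H] := @local_to_uniform (fun k x => u <= x -> dst x u + k < r).
  (* Near a point a < u the premise [u <= x] fails, so nothing has to be shown. *)
  move=> a ta; have [au|ua] := ltP a u.
    exists (u - a); first by rewrite subr_gt0.
    move=> k x _ _ _ + ux; rewrite distrC ger0_norm ?subr_ge0 ?(le_trans (ltW au))//.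
    by rewrite ltrD2r ltNge ux.
  have g0 : 0 < (r - dst a u) / 2.
    by rewrite divr_gt0// subr_gt0 Hr//; case/andP: ta.
  have [h h0 Hh] := dst_cont ta g0.
  exists (Num.min h ((r - dst a u) / 2)); first by rewrite lt_min h0.
  move=> k x k0; rewrite !lt_min => /andP[_ kd] tx /andP[ax _] ux.
  have := Hh _ tx ax; have := dst_tri x u a; rewrite (dst_sym x a).
  move: kd; lra.
exists k => // s us sT; apply: H => //.
by rewrite /in_time (le_trans u0).
Qed.

(** A continuous path need not be Lipschitz, but its steps shorter than [h] stay below the threshold
    and are free, while the longer ones cost at most [M / rho], that is [M / rho / h] per unit of
    time. *)
Lemma excess_lipschitz rho : 0 < rho -> exists C, forall a b, 0 <= a -> a <= b -> b <= T ->
  excess rho (dst a b) <= C * (b - a).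
Proof.
move=> r0; have r30 : 0 < 3 * rho by rewrite mulr_gt0.
have [h h0 Hh] := dst_uniform r30.
have [M HM] := dst_bounded.
have M0 : 0 <= M.
  have t0 : in_time T 0 by rewrite /in_time lexx ltW.
  exact: le_trans (HM 0 0 t0 t0).
exists (M / rho / h) => a b a0 ab bT.
have ta : in_time T a by rewrite /in_time a0 (le_trans ab).
have tb : in_time T b by rewrite /in_time (le_trans a0 ab).
have [bah|hba] := ltP (b - a) h.
  rewrite excess_eq0; last by apply/ltW/Hh => //; rewrite distrC ger0_norm ?subr_ge0.
  by rewrite mulr_ge0 ?subr_ge0// !divr_ge0// ltW.
apply: (@le_trans _ _ (M / rho)).
  rewrite ler_pM2r ?invr_gt0// ge_max M0/=.
  by have := HM _ _ ta tb; move: r30; lra.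
rewrite -[leLHS]mulr1 -[leRHS]mulrA ler_wpM2l ?divr_ge0 ?(ltW r0)//.
by rewrite mulrC ler_pdivlMr// mul1r.
Qed.

End PathMetric.

Section LogDistance.
Context {R : realType} {n : nat}.

Definition log_dist (x y : 'I_n -> R) : R := \sum_(i < n) `|ln (x i) - ln (y i)|.

Lemma log_dist_ge0 x y : 0 <= log_dist x y.
Proof. by apply: sumr_ge0. Qed.

Lemma log_dist_sym x y : log_dist x y = log_dist y x.
Proof. by apply: eq_bigr => i _; rewrite distrC. Qed.

Lemma log_dist_tri x y z : log_dist x y <= log_dist x z + log_dist z y.
Proof.
by rewrite /log_dist -big_split ler_sum//= => i _; exact: ler_distD.
Qed.

Lemma log_dist_ge x y i : `|ln (x i) - ln (y i)| <= log_dist x y.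
Proof. by rewrite /log_dist (bigD1 i)//= lerDl sumr_ge0. Qed.

Lemma ln_lipschitz (m x y : R) : 0 < m -> m <= x -> m <= y ->
  `|ln x - ln y| <= `|x - y| / m.
Proof.
move=> m0.
have H a b : m <= a -> m <= b -> ln a - ln b <= `|a - b| / m.
  move=> ma mb; have a0 := lt_le_trans m0 ma; have b0 := lt_le_trans m0 mb.
  rewrite -ln_div ?posrE//.
  have -> : a / b = 1 + (a / b - 1) by rewrite addrC subrK.
  apply: (@le_trans _ _ (a / b - 1)).
    by apply: le_ln1Dx; rewrite -subr_gt0 opprK subrK divr_gt0.
  have -> : a / b - 1 = (a - b) / b by rewrite mulrBl divff// gt_eqF.
  apply: (@le_trans _ _ (`|a - b| / b)).
    by rewrite ler_pM2r ?invr_gt0// ler_norm.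
  by rewrite ler_wpM2l// lef_pV2.
move=> mx my; rewrite ler_norml H// andbT lerNl opprB.
by rewrite distrC H.
Qed.

End LogDistance.

(** * Continuous paths in O and the open sets of frozen paths *)

Section Paths.
Context {R : realType}.
Variable T : R.
Hypothesis T0 : 0 < T.

Lemma within_continuous_eps (f : R -> R) :
  {within `[0, T], continuous f} <->
  forall a, in_time T a -> forall e, 0 < e ->
    exists2 h, 0 < h & forall b, in_time T b -> `|a - b| < h -> `|f a - f b| < e.
Proof.
rewrite subspace_continuousP; split => [fc a ta e e0|H a].
  have /fc /cvgrPdist_lt /(_ _ e0) : `[0, T]%classic a by rewrite /= in_itv.
  rewrite near_withinE => /nbhs_ballP[h /= h0 Hh]; exists h => // b tb ab.
  by apply: Hh => //=; rewrite in_itv.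
rewrite /= in_itv /= => ta; apply/cvgrPdist_lt => e e0.
rewrite near_withinE; apply/nbhs_ballP; have [h h0 Hh] := H a ta e e0.
by exists h => // b ab /=; rewrite in_itv/= => tb; exact: Hh.
Qed.

Lemma finite_pos_bound (n : nat) (P : 'I_n -> R -> Prop) :
  (forall i h k, P i h -> 0 < k -> k <= h -> P i k) ->
  (forall i, exists2 h, 0 < h & P i h) -> exists2 h, 0 < h & forall i, P i h.
Proof.
move=> Pmon HP; have H i : exists h, 0 < h /\ P i h by have [h] := HP i; exists h.
have [h Hh] := choice H.
exists (\big[Num.min/1]_(i < n) h i).
  by apply/bigmin_gtP; split => // i _; have [] := Hh i.
move=> i; have [hi Pi] := Hh i; apply: Pmon Pi _ _.
  by apply/bigmin_gtP; split => // j _; have [] := Hh j.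
exact: bigmin_le_cond.
Qed.

Context {n : nat} (delta : R).

Lemma Cpath_lower_bound (g : R -> 'I_n -> R) : Cpath delta T g ->
  exists2 m, 0 < m & forall t i, in_time T t -> m <= g t i.
Proof.
move=> [gc gO]; have [|i|m m0 H] := @finite_pos_bound n
  (fun i m => forall t, in_time T t -> m <= g t i).
- by move=> i h k H _ kh t tt; apply: le_trans kh (H t tt).
- have [c c0 H] := EVT_min (ltW T0) (gc i).
  exists (g c i); first by have [+ _] := gO c c0; apply.
  by move=> t tt; apply: H; rewrite in_itv.
by exists m => // t i; exact: H.
Qed.

Lemma Cpath_log_near (g : R -> 'I_n -> R) : Cpath delta T g ->
  forall r, 0 < r -> exists2 e, 0 < e & forall t y, in_time T t ->
    (forall i, 0 < y i) -> (forall i, `|y i - g t i| < e) -> log_dist y (g t) < r.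
Proof.
move=> gC r r0; have [m m0 Hm] := Cpath_lower_bound gC.
have m20 : 0 < m / 2 by rewrite divr_gt0.
have n0 : 0 < n.+1%:R :> R by [].
(* The first bound keeps [y] above [m / 2], where the logarithm is Lipschitz with constant 2/m;
   dividing by n+1 instead of n makes the sum of n terms strictly less than [r]. *)
exists (Num.min (m / 2) (r / n.+1%:R * (m / 2))).
  by rewrite lt_min m20 mulr_gt0 ?divr_gt0.
move=> t y tt y0 yg.
apply: (@le_lt_trans _ _ (\sum_(i < n) r / n.+1%:R)).
  apply: ler_sum => i _; have := yg i; rewrite lt_min => /andP[y1 y2].
  have gm := Hm t i tt.
  apply: (le_trans (@ln_lipschitz _ (m / 2) _ _ m20 _ _)).
  - by move: y1; rewrite ltr_norml => /andP[+ _]; lra.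
  - by move: m0; lra.
  by rewrite ler_pdivrMr// ltW.
rewrite sumr_const card_ord -[X in X < _]mulr_natl mulrCA gtr_pMr//.
by rewrite ltr_pdivrMr// mul1r ltr_nat.
Qed.

Lemma Cpath_log_cont (g : R -> 'I_n -> R) : Cpath delta T g ->
  forall a, in_time T a -> forall e, 0 < e ->
  exists2 h, 0 < h & forall b, in_time T b -> `|a - b| < h -> log_dist (g a) (g b) < e.
Proof.
move=> gC a ta e e0; have [r r0 Hr] := Cpath_log_near gC e0.
case: (gC) => gc gO.
have [||h h0 H] := @finite_pos_bound n
  (fun i h => forall b, in_time T b -> `|a - b| < h -> `|g a i - g b i| < r).
- by move=> i h k H _ kh b tb /lt_le_trans /(_ kh); exact: H.
- by move=> i; exact: ((within_continuous_eps _).1 (gc i) a ta r r0).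
exists h => // b tb ab; rewrite log_dist_sym; apply: (Hr a) => //.
  by move=> i; have [+ _] := gO b tb; apply.
by move=> i; rewrite distrC; exact: H.
Qed.

Definition freeze_paths (u r : R) : set (R -> 'I_n -> R) :=
  [set g | Cpath delta T g /\
    forall s, u <= s -> s <= T -> log_dist (g s) (g u) < r].

(** The margin [k] is shared between the two perturbed positions, at time s and at time u. *)
Lemma freeze_paths_open u r : in_time T u -> open_Cpaths delta T (freeze_paths u r).
Proof.
move=> tu; split; first by move=> g [].
move=> g [gC gu].
have [k k0 Hk] := dst_margin (fun a b => log_dist_sym (g a) (g b))
  (fun a b c => log_dist_tri (g a) (g b) (g c)) (Cpath_log_cont gC) tu gu.
have k20 : 0 < k / 2 by rewrite divr_gt0.
have [e e0 He] := Cpath_log_near gC k20.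
exists e => // h hC hg; split => // s us sT.
case/andP: (tu) => u0 uT.
have ts : in_time T s by rewrite /in_time (le_trans u0 us).
have h0 t i : in_time T t -> 0 < h t i by move=> tt; have [_ /(_ t tt)[+ _]] := hC; apply.
have := Hk s us sT.
have : log_dist (h s) (g s) < k / 2.
  by apply: (He s) => // i; [exact: h0|exact: hg].
have : log_dist (h u) (g u) < k / 2.
  by apply: (He u) => // i; [exact: h0|exact: hg].
have := log_dist_tri (h s) (h u) (g s).
have := log_dist_tri (g s) (h u) (g u).
rewrite (log_dist_sym (g u) (h u)); lra.
Qed.

(** A path that is still close to its position at u by time v agrees up to v with a member of the
    open set, namely itself stopped at v: the premise of conditional full support at v. *)
Lemma freeze_paths_stop (g : R -> 'I_n -> R) u v r : Cpath delta T g ->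
  0 <= u -> u <= v -> v <= T ->
  (forall s, u <= s -> s <= v -> log_dist (g s) (g u) < r) ->
  freeze_paths u r (fun s => g (Num.min s v)).
Proof.
move=> gC u0 uv vT H; have [gc gO] := gC.
have tmin s : in_time T s -> in_time T (Num.min s v).
  by move=> /andP[s0 sT]; rewrite /in_time le_min s0 (le_trans u0 uv) ge_min sT.
split; last first.
  move=> s us sT; rewrite (min_l uv); apply: H; first by rewrite le_min us.
  by rewrite ge_min lexx orbT.
split; last by move=> t tt; apply: gO; exact: tmin.
move=> i; apply/within_continuous_eps => a ta e e0.
have [h h0 Hh] := (within_continuous_eps _).1 (gc i) _ (tmin a ta) e e0.
exists h => // b tb ab; apply: Hh; first exact: tmin.
apply: le_lt_trans ab.
have h1 := ler_norm (a - b); have := ler_norm (b - a); rewrite distrC => h2.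
rewrite ler_norml /Num.min; case: ltP => av; case: ltP => bv; lra.
Qed.

End Paths.

(** * Conditional probabilities and the maximal inequality *)

Section ConditionalProbability.
Context {d : measure_display} {Omega : measurableType d} {R : realType}.
Variable P : probability Omega R.

Definition is_cond_prob (G : set (set Omega)) (B : set Omega) (p : Omega -> R) :=
  [/\ G_measurable G p, (forall w, 0 <= p w) &
    forall A, G A -> P (B `&` A) = (\int[P]_(w in A) (p w)%:E)%E].

(** The set where [Y] is negative lies in [G], and there the integral of [Y] equals that of an
    indicator; so it is null, and the positive part is again a version. Measurability of [B] is read
    off its indicator. *)
Lemma cond_prob_of_cond_exp (G : set (set Omega)) (B : set Omega) (Y : Omega -> R) :
  sigma_algebra setT G -> G `<=` measurable ->
  is_cond_exp P G (\1_B : Omega -> R) Y ->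
  measurable B /\ is_cond_prob G B (fun w => Num.max (Y w) 0).
Proof.
move=> sG Gm [mB _ GY iY HY].
have {}mB : measurable B by exact: ((@measurable_indicP _ _ R B).2 mB).
have mGY := (G_measurableE sG _).1 GY.
have mY : measurable_fun setT Y := G_measurable_measurable Gm GY.
split => //; split.
- apply/(G_measurableE sG).
  exact: (measurable_funrpos mGY).
- by move=> w; rewrite le_max lexx orbT.
move=> A GA; have mA := Gm _ GA.
rewrite -integral_indic// HY//.
pose N := [set w | Y w < 0].
have GN : G N.
  apply/(sub_measurableP sG).
  have := @measurable_fun_ltr _ _ _ _ _ _ mGY (measurable_cst (0:R)) => /(_ measurableT [set true]).
  by rewrite setTI; apply.
have mN := Gm _ GN.
have N0 : P N = 0%E.
  apply: (@pos_integral_eq0 _ _ _ P N (fun w => - Y w)) => //.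
  - exact: measurableT_comp.
  - by move=> w; rewrite oppr_gt0.
  under eq_integral do rewrite -mulN1r EFinM.
  rewrite integralZl//; last exact: integrableS iY.
  by rewrite -HY// integral_indic// EFinN mulN1e leeNl oppe0.
apply: ae_eq_integral => //.
- by apply/measurable_EFinP/measurable_funTS.
- apply/measurable_EFinP/measurable_funTS.
  exact: (measurable_funrpos mY).
exists N; split => // w; apply: contra_notP => /= /negP.
by rewrite -leNgt => Yw _; rewrite max_l.
Qed.

Variables (T : R) (F : R -> set (set Omega)).
Hypothesis sF : forall t, in_time T t -> sigma_algebra setT (F t).
Hypothesis Fm : forall t, in_time T t -> F t `<=` measurable.
Hypothesis Fle : forall s t, 0 <= s -> s <= t -> t <= T -> F s `<=` F t.
Variables (p : R -> Omega -> R) (M : Omega -> R).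
Hypothesis p0 : forall t w, 0 <= p t w.
Hypothesis M0 : forall w, 0 <= M w.
Hypothesis mM : measurable_fun setT M.

(* Doob's argument: split A according to whether p is below lam at the first
   time of l. *)
Lemma maximal_inequality (lam : R) (l : seq R) s A : 0 <= lam ->
  (forall t, t \in l -> in_time T t) ->
  (forall t, t \in l -> G_measurable (F t) (p t)) ->
  (forall t, t \in l -> forall B, F t B ->
     \int[P]_(w in B) (M w)%:E <= \int[P]_(w in B) (p t w)%:E)%E ->
  in_time T s -> path <=%R s l -> F s A ->
  (\int[P]_(w in A `&` [set w | has (fun t => (p t w < lam)%R) l]) (M w)%:E
     <= lam%:E * P A)%E.
Proof.
move=> lam0; elim: l s A => [|t l IH] s A lT pG Mp ts /=.
  move=> _ _; rewrite (_ : _ `&` _ = set0) ?integral_set0.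
    by rewrite mule_ge0// lee_fin.
  by apply/seteqP; split => w //= [].
move=> /andP[st ptl] FA.
have tl : t \in t :: l by rewrite mem_head.
have tt := lT t tl.
have FtA : F t A by apply: Fle FA => //; [case/andP: ts|case/andP: tt].
have mGp := (G_measurableE (sF tt) _).1 (pG t tl).
have mp := G_measurable_measurable (Fm tt) (pG t tl).
have F1 : F t (A `&` [set w | p t w < lam]).
  apply/(sub_measurableP (sF tt)); apply: measurableI; first exact/(sub_measurableP (sF tt)).
  have := @measurable_fun_ltr _ _ _ _ _ _ mGp (measurable_cst lam) => /(_ measurableT [set true]).
  by rewrite setTI; apply.
have F2 : F t (A `&` [set w | lam <= p t w]).
  apply/(sub_measurableP (sF tt)); apply: measurableI; first exact/(sub_measurableP (sF tt)).
  have := @measurable_fun_ler _ _ _ _ _ _ (measurable_cst lam) mGp => /(_ measurableT [set true]).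
  by rewrite setTI; apply.
set A1 := A `&` [set w | p t w < lam] in F1 *.
set A2 := A `&` [set w | lam <= p t w] in F2 *.
have mA1 := Fm tt F1; have mA2 := Fm tt F2.
have mH : measurable [set w | has (fun t => p t w < lam) l].
  elim: {IH ptl Mp tl} l lT pG => [|u l IH] lT pG.
    by rewrite [X in measurable X](_ : _ = set0)//; apply/seteqP; split.
  rewrite [X in measurable X](_ : _ = [set w | p u w < lam] `|` [set w | has (fun t0 => p t0 w < lam) l]); last first.
    by apply/seteqP; split => w /= /orP.
  have ul : u \in t :: u :: l by rewrite !inE eqxx orbT.
  have mpu := G_measurable_measurable (Fm (lT u ul)) (pG u ul).
  apply: measurableU.
    have := @measurable_fun_ltr _ _ _ _ _ _ mpu (measurable_cst lam) => /(_ measurableT [set true]).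
    by rewrite setTI; apply.
  by apply: IH => x xl; [apply: lT|apply: pG]; move: xl; rewrite !inE => /orP[->//|->]; rewrite !orbT.
set H := [set w | has _ l] in mH.
rewrite [X in (integral _ X _ <= _)%E](_ : _ = A1 `|` (A2 `&` H)); last first.
  apply/seteqP; split => w.
    move=> [Aw /orP[h|h]]; first by left.
    by have [h'|h'] := ltP (p t w) lam; [left|right].
  by move=> [[Aw h]|[[Aw h] h']]; split => //; apply/orP; [left|right].
rewrite ge0_integral_setU//=; last 4 first.
- exact: measurableI.
- by apply/measurable_EFinP/measurable_funTS.
- by move=> w _; rewrite lee_fin.
- apply/disj_setPS => w [[_ h1] [[_ h2] _]].
  by move: h1; rewrite /= ltNge h2.
have -> : P A = (P A1 + P A2)%E.
  rewrite -measureU//.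
    congr (P _); apply/seteqP; split => w; last by move=> [[]|[]].
    by move=> Aw; have [h'|h'] := ltP (p t w) lam; [left|right].
  apply/seteqP; split => w // [[_ h1] [_ h2]].
  by move: h1; rewrite /= ltNge h2.
rewrite ge0_muleDr//; apply: leeD; last first.
  apply: IH F2 => //.
  - by move=> x xl; apply: lT; rewrite inE xl orbT.
  - by move=> x xl; apply: pG; rewrite inE xl orbT.
  - by move=> x xl; apply: Mp; rewrite inE xl orbT.
apply: le_trans (Mp t tl _ F1) _.
rewrite -integral_cst//; apply: ge0_le_integral => //.
- by move=> w _; rewrite lee_fin.
- by apply/measurable_EFinP/measurable_funTS.
- by move=> w [_ /= h]; rewrite lee_fin ltW.
Qed.

(** The maximal inequality at level 1/(j+1) bounds the integral of [M] over [E j k] uniformly in k.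
    Letting k and then j grow, [M] integrates to 0 over the event that the infimum vanishes, so that
    event meets [M > 0] in a null set. *)
Lemma infimum_positive (tau : nat -> R) :
  (forall k, in_time T (tau k)) ->
  (forall k, G_measurable (F (tau k)) (p (tau k))) ->
  (forall k B, F (tau k) B ->
     \int[P]_(w in B) (M w)%:E <= \int[P]_(w in B) (p (tau k) w)%:E)%E ->
  {ae P, forall w, 0 < M w -> exists2 lam, 0 < lam & forall k, lam <= p (tau k) w}.
Proof.
move=> tauT pG Mp.
pose E j k := [set w | has (fun t => p t w < j.+1%:R^-1) [seq tau i | i <- iota 0 k]].
have mE j k : measurable (E j k).
  rewrite (_ : E j k = \big[setU/set0]_(i <- iota 0 k) [set w | p (tau i) w < j.+1%:R^-1]).
    apply: bigsetU_measurable => i _.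
    have mpi := G_measurable_measurable (Fm (tauT i)) (pG i).
    have := @measurable_fun_ltr _ _ _ _ _ _ mpi (measurable_cst (j.+1%:R^-1 : R)) => /(_ measurableT [set true]).
    by rewrite setTI; apply.
  rewrite /E; elim: (iota 0 k) => [|i l IH].
    by rewrite big_nil; apply/seteqP; split.
  by rewrite big_cons -IH; apply/seteqP; split => w /= /orP.
have EM j k : (\int[P]_(w in E j k) (M w)%:E <= (j.+1%:R^-1)%:E)%E.
  have zT : in_time T 0.
    by have /andP[t0 tT] := tauT 0%N; rewrite /in_time lexx (le_trans t0).
  have j0 : 0 <= j.+1%:R^-1 :> R by rewrite invr_ge0.
  have F0T : F 0 setT.
    by apply/(sub_measurableP (sF zT)); exact: measurableT.
  (* The maximal inequality wants increasing times; sorting the enumerated ones leaves the event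
     unchanged. *)
  have := @maximal_inequality _ (sort <=%R [seq tau i | i <- iota 0 k]) 0 setT j0.
  rewrite setTI probability_setT mule1.
  rewrite [X in integral _ X](_ : _ = E j k); last first.
    by apply/seteqP; split => w; rewrite /E /= !has_map; rewrite (eq_has_r (mem_sort _ _)) ?has_map.
  apply => //.
  - by move=> t; rewrite mem_sort => /mapP[i _ ->].
  - by move=> t; rewrite mem_sort => /mapP[i _ ->].
  - by move=> t; rewrite mem_sort => /mapP[i _ ->]; exact: Mp.
  - rewrite path_min_sorted; first by apply: sort_sorted; exact: le_total.
    by apply/allP => t; rewrite mem_sort => /mapP[i _ ->]; case/andP: (tauT i).
have nE j : nondecreasing_seq (E j).
  apply/nondecreasing_seqP => k; rewrite subsetEset => w.
  move=> h; suff : has (fun t => p t w < j.+1%:R^-1) [seq tau i | i <- iota 0 (k + 1)] by rewrite addn1.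
  by rewrite iotaD map_cat has_cat; apply/orP; left.
pose N := \bigcap_j \bigcup_k E j k.
have mUE j : measurable (\bigcup_k E j k) by exact: bigcup_measurable.
have mN : measurable N by exact: bigcap_measurable.
have NM j : (\int[P]_(w in N) (M w)%:E <= (j.+1%:R^-1)%:E)%E.
  apply: (@le_trans _ _ (\int[P]_(w in \bigcup_k E j k) (M w)%:E)%E).
    apply: ge0_subset_integral => //.
    - by apply/measurable_EFinP/measurable_funTS.
    - by move=> w _; rewrite lee_fin.
    - by move=> w; apply.
  have cv := @ge0_nondecreasing_set_cvg_integral _ _ _ (E j) (EFin \o M) P (nE j) (mE j)
    (fun k => measurable_funTS ((measurable_EFinP _ _).2 mM))
    (fun _ w _ => eq_ind_r is_true (M0 w) (lee_fin 0 (M w))).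
  rewrite -(cvg_lim _ cv)//; apply: lime_le; first exact: cvgP cv.
  by apply: nearW => k; exact: EM.
have NM0 : (\int[P]_(w in N) (M w)%:E <= 0)%E.
  apply/lee_addgt0Pr => e e0; rewrite add0e.
  have [k] := ltr_add_invr e0.
  rewrite add0r => ke; apply: le_trans (NM k) _.
  by rewrite lee_fin ltW.
pose M1 := [set w | 0 < M w].
have mM1 : measurable M1.
  have := @measurable_fun_ltr _ _ _ _ _ _ (measurable_cst (0:R)) mM => /(_ measurableT [set true]).
  by rewrite setTI; apply.
exists (N `&` M1); split; first exact: measurableI.
  apply: (@pos_integral_eq0 _ _ _ P _ M) => //; first exact: measurableI.
    by move=> w [].
  apply: le_trans NM0; apply: ge0_subset_integral => //; first exact: measurableI.
    by apply/measurable_EFinP/measurable_funTS.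
  by move=> w _; rewrite lee_fin.
move=> w; apply: contra_notP => NMw Mw.
have : ~ N w by move=> Nw; apply: NMw.
rewrite /N -[X in X -> _]/((~` _) w) setC_bigcap => -[j _ /= Hj].
exists j.+1%:R^-1; first by rewrite invr_gt0.
move=> k; rewrite leNgt; apply/negP => pk; apply: Hj.
exists k.+1 => //; apply/hasP; exists (tau k) => //.
by apply: map_f; rewrite mem_iota add0n ltnS leqnn.
Qed.

End ConditionalProbability.

(** * Freezing probabilities *)

Section FreezeProbability.
Context {d : measure_display} {Omega : measurableType d} {R : realType}.
Variables (P : probability Omega R) (T : R) (F : R -> set (set Omega)).
Variables (n : nat) (delta : R) (S : R -> Omega -> 'I_n -> R).
Hypothesis T0 : 0 < T.
Hypothesis sF : forall t, in_time T t -> sigma_algebra setT (F t).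
Hypothesis Fm : forall t, in_time T t -> F t `<=` measurable.
Hypothesis Fle : forall s t, 0 <= s -> s <= t -> t <= T -> F s `<=` F t.
Hypothesis F_null : forall N, measurable N -> P N = 0%E -> F 0 N.
Hypothesis S_path : forall w, Cpath delta T (fun t => S t w).
Hypothesis S_CFS : CFS delta T P F S.

Definition freeze_event (u r : R) : set Omega :=
  [set w | freeze_paths T delta u r (fun s => S s w)].

(** The event starts at u but is conditioned at the later time v, which makes a single event serve
    for all times of [u,v]. *)
Lemma freeze_cond_prob u v r : 0 <= u -> u <= v -> v <= T ->
  measurable (freeze_event u r) /\
  exists M, is_cond_prob P (F v) (freeze_event u r) M /\
    {ae P, forall w,
      (forall s, u <= s -> s <= v -> log_dist (S s w) (S u w) < r) -> 0 < M w}.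
Proof.
move=> u0 uv vT.
have tv : in_time T v by rewrite /in_time (le_trans u0 uv).
have tu : in_time T u by rewrite /in_time u0 (le_trans uv).
have [Y HY Ypos] := S_CFS tv (freeze_paths_open T0 delta r tu).
have [mB Hp] := cond_prob_of_cond_exp (sF tv) (Fm tv) HY.
split => //; exists (fun w => Num.max (Y w) 0); split => //.
apply: filterS Ypos => w Hw Hd; rewrite lt_max Hw//.
exists (fun s => S (Num.min s v) w).
  exact: (freeze_paths_stop (S_path w)).
by move=> s /andP[_ sv]; rewrite min_l.
Qed.

Lemma log_dist_uniform w e : 0 < e -> exists2 h, 0 < h &
  forall a b, in_time T a -> in_time T b -> `|a - b| < h -> log_dist (S a w) (S b w) < e.
Proof.
apply: (@dst_uniform _ T (fun a b => log_dist (S a w) (S b w))).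
- by move=> a b; exact: log_dist_sym.
- by move=> a b c; exact: log_dist_tri.
- exact: (Cpath_log_cont T0 (S_path w)).
Qed.

Lemma freeze_probability rho : 0 < rho -> exists p : R -> Omega -> R,
  (forall t, in_time T t -> is_cond_prob P (F t) (freeze_event t rho) (p t)) /\
  (forall w, exists2 lam, 0 < lam &
     forall q : rat, 0 <= q <= 1 -> lam <= p (grid T q) w).
Proof.
move=> rho0; have rho20 : 0 < rho / 2 by rewrite divr_gt0.
have Hp t : exists p : Omega -> R, (forall w, 0 <= p w) /\
    (in_time T t -> is_cond_prob P (F t) (freeze_event t rho) p).
  have [/andP[t0 tT]|] := pselect (in_time T t); last by exists (cst 0).
  have [_ [M [HM _]]] := freeze_cond_prob rho t0 (lexx t) tT.
  by exists M; split => //; case: HM.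
have {Hp} [p Hp] := choice Hp.
have p0 t w : 0 <= p t w by have [+ _] := Hp t; apply.
have pG t : in_time T t -> G_measurable (F t) (p t).
  by move=> tt; have [_ /(_ tt)[]] := Hp t.
have pE t A : in_time T t -> F t A ->
    P (freeze_event t rho `&` A) = (\int[P]_(w in A) (p t w)%:E)%E.
  by move=> tt FA; have [_ /(_ tt)[_ _]] := Hp t; apply.
have mfe t r : in_time T t -> measurable (freeze_event t r).
  by move=> /andP[t0 tT]; have [] := freeze_cond_prob r t0 (lexx t) tT.
(* For t in [u, v], freezing within rho / 2 from time u on, while staying there
   up to v, implies freezing within rho from time t on; hence p t dominates the
   conditional expectation of M, which is positive on the paths that have not
   moved by rho / 2 on [u, v]. *)
have local u v : 0 <= u -> u <= v -> v <= T -> {ae P, forall w,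
    (forall s, u <= s -> s <= v -> log_dist (S s w) (S u w) < rho / 2) ->
    exists2 lam, 0 < lam & forall q, u <= grid T q <= v -> lam <= p (grid T q) w}.
  move=> u0 uv vT.
  have tv : in_time T v by rewrite /in_time (le_trans u0 uv).
  have [mB [M [[MG M0 ME] Mpos]]] := freeze_cond_prob (rho / 2) u0 uv vT.
  (* Enumerates the grid times of [u,v], with u itself as default value. *)
  pose tau k := if (unpickle k : option rat) is Some q then
    if u <= grid T q <= v then grid T q else u else u.
  have tauuv k : u <= tau k <= v.
    by rewrite /tau; case: unpickle => [q|]; rewrite ?lexx//; case: ifP; rewrite ?lexx.
  have tauT k : in_time T (tau k).
    by have /andP[uk kv] := tauuv k; rewrite /in_time (le_trans u0 uk) (le_trans kv).
  have mM := G_measurable_measurable (Fm tv) MG.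
  have Mp k B : F (tau k) B ->
     (\int[P]_(w in B) (M w)%:E <= \int[P]_(w in B) (p (tau k) w)%:E)%E.
    move=> FB; have /andP[uk kv] := tauuv k.
    have FvB : F v B by apply: Fle FB => //; case/andP: (tauT k).
    have mBB := Fm tv FvB.
    rewrite -ME// -pE//; apply: le_measure; rewrite ?inE; [exact: measurableI|
      by apply: measurableI => //; exact: mfe|].
    apply: setSI => w [Cw Hw]; split => // s ks sT.
    apply: le_lt_trans (log_dist_tri _ _ (S u w)) _.
    rewrite [ltRHS](splitr rho) ltrD ?Hw ?(le_trans uk)// log_dist_sym Hw//.
    by case/andP: (tauT k).
  have := @infimum_positive _ _ _ P T F sF Fm Fle p M p0 M0 mM tau tauT
    (fun k => pG _ (tauT k)) Mp.
  move=> Hinf; apply: filterS2 Mpos Hinf => w H1 H2 /H1 /H2 [lam lam0 Hlam].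
  exists lam => // q quv; have := Hlam (pickle q).
  by rewrite /tau pickleK quv.
have all_ae : {ae P, forall w, exists2 lam, 0 < lam &
    forall q : rat, 0 <= q <= 1 -> lam <= p (grid T q) w}.
  (* The mesh fine enough for a path depends on the path, so the local statement is first gathered
     over all uniform partitions, which are countably many; the mesh is then chosen by uniform
     continuity. *)
  have H : {ae P, forall w, forall m j, (j < m.+1)%N ->
      (forall s, T * (j%:R / m.+1%:R) <= s -> s <= T * (j.+1%:R / m.+1%:R) ->
         log_dist (S s w) (S (T * (j%:R / m.+1%:R)) w) < rho / 2) ->
    exists2 lam, 0 < lam & forall q, T * (j%:R / m.+1%:R) <= grid T q <= T * (j.+1%:R / m.+1%:R)
       -> lam <= p (grid T q) w}.
    apply: ae_foralln => m; apply: ae_foralln => j.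
    have [jm|] := boolP (j < m.+1)%N; last by move=> _; apply: aeW.
    have m0 : 0 < m.+1%:R :> R by [].
    have H1 : 0 <= T * (j%:R / m.+1%:R) by rewrite mulr_ge0 ?(ltW T0)// divr_ge0.
    have H2 : T * (j%:R / m.+1%:R) <= T * (j.+1%:R / m.+1%:R).
      by rewrite ler_pM2l// ler_pM2r ?invr_gt0// ler_nat.
    have H3 : T * (j.+1%:R / m.+1%:R) <= T.
      by rewrite ger_pMr// ler_pdivrMr// mul1r ler_nat.
    by apply: filterS (local _ _ H1 H2 H3) => w Hw _; exact: Hw.
  apply: filterS H => w Hw.
  have [h h0 Hh] := log_dist_uniform w rho20.
  have [m] := ltr_add_invr (divr_gt0 h0 T0); rewrite add0r => Hm.
  have m0 : 0 < m.+1%:R :> R by [].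
  have {}Hm : T / m.+1%:R < h by rewrite mulrC -ltr_pdivlMr.
  have tj j : (j <= m.+1)%N -> in_time T (T * (j%:R / m.+1%:R)).
    move=> jm; rewrite /in_time mulr_ge0 ?(ltW T0) ?divr_ge0//=.
    by rewrite ger_pMr// ler_pdivrMr// mul1r ler_nat.
  have [||lam lam0 Hlam] := @finite_pos_bound R m.+1 (fun j lam =>
    forall q, T * (j%:R / m.+1%:R) <= grid T q <= T * (j.+1%:R / m.+1%:R)
       -> lam <= p (grid T q) w).
  - by move=> j h1 k H _ kh q /H; exact: le_trans.
  - move=> j; apply: Hw => // s us sv.
    have /andP[u0 uT] := tj j (ltnW (ltn_ord j)).
    have /andP[v0 vT] := tj j.+1 (ltn_ord j).
    apply: Hh; rewrite /in_time ?u0 ?(le_trans u0 us) ?(le_trans sv)//.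
    rewrite ger0_norm ?subr_ge0//; apply: le_lt_trans Hm.
    rewrite lerBlDl; apply: le_trans sv _.
    by rewrite -mulrDr -[X in _ <= _ * (_ + X)]mul1r -mulrDl -natr1.
  exists lam => // q /andP[q0 q1].
  (* The subintervals are closed, so that [q = 1] falls into the last one. *)
  have : exists j : 'I_m.+1, j%:R <= ratr q * m.+1%:R :> R /\ ratr q * m.+1%:R <= j.+1%:R :> R.
    have : 0 <= ratr q * m.+1%:R :> R by rewrite mulr_ge0// ler0q.
    have : ratr q * m.+1%:R <= m.+1%:R :> R.
      by rewrite ger_pMl// -(rmorph1 (ratr : rat -> R)) ler_rat.
    move: (ratr q * m.+1%:R) => x; clear.
    elim: m => [|m IH] xm x0; first by exists ord0.
    have [xm'|mx] := leP x m.+1%:R.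
      have [j [j1 j2]] := IH xm' x0.
      by exists (widen_ord (leqnSn _) j).
    by exists ord_max; rewrite ltW.
  move=> [j [j1 j2]]; apply: (Hlam j); rewrite /grid !ler_pM2l//.
  by rewrite ler_pdivrMr// ler_pdivlMr// j1.
case: all_ae => N [mN N0 HN].
have FN t : in_time T t -> F t N.
  by move=> /andP[t0 tT]; apply: (Fle (lexx 0) t0 tT); exact: F_null.
(* The value 1 on the null set [N] makes the infimum positive at every w. Since [N] belongs to every
   [F t], adaptedness survives. *)
exists (fun t w => if w \in N then 1 else p t w); split.
  move=> t tt; split.
  - apply/(G_measurableE (sF tt)); apply: measurable_fun_ifT => //.
    + apply: (measurable_fun_bool true) => /=.
      by rewrite setTI preimage_mem_true; apply/(sub_measurableP (sF tt)); exact: FN.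
    + exact: (G_measurableE (sF tt) _).1 (pG t tt).
  - by move=> w; case: ifP.
  move=> A FA; rewrite pE//; have mA := Fm tt FA.
  have mp := G_measurable_measurable (Fm tt) (pG t tt).
  apply: ae_eq_integral => //.
  - by apply/measurable_EFinP/measurable_funTS.
  - apply/measurable_EFinP/measurable_funTS; apply: measurable_fun_ifT => //.
    by apply: (measurable_fun_bool true) => /=; rewrite setTI preimage_mem_true.
  exists N; split => // w; apply: contra_notP => Nw _.
  by rewrite memNset.
move=> w; have [wN|wN] := boolP (w \in N); first by exists 1.
apply: contrapT => h; move/negP: wN; apply; apply/mem_set; exact: HN.
Qed.

End FreezeProbability.

(** * The density *)

Section PriceGap.
Context {R : realType}.

Lemma le_expR_ln_dist (x y D : R) : 0 < x -> 0 < y -> `|ln x - ln y| <= D ->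
  x <= y * expR D.
Proof.
move=> x0 y0 H; rewrite -[leLHS]lnK ?posrE// -[X in _ <= X * _]lnK ?posrE//.
rewrite -expRD ler_expR.
by have := le_trans (ler_norm _) H; lra.
Qed.

Lemma dist_le_expR_ln_dist (x y D : R) : 0 < x -> 0 < y -> `|ln x - ln y| <= D ->
  `|x - y| <= (expR D - 1) * y.
Proof.
move=> x0 y0 H; have h1 := le_expR_ln_dist x0 y0 H.
have h2 : y <= x * expR D by apply: le_expR_ln_dist => //; rewrite distrC.
have eD : 1 <= expR D by rewrite -expR0 ler_expR (le_trans _ H).
(* The lower half of the bound: if x < y then y - x is at most (exp D - 1) x, hence at most (exp D -
   1) y. *)
have h3 : 2 * y - x <= y * expR D.
  have [xy|yx] := leP y x; last first.
    have : y * (expR D - 1) - x * (expR D - 1) >= 0.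
      by rewrite -mulrBl mulr_ge0 ?subr_ge0// ltW.
    lra.
  have : y * (expR D - 1) >= 0 by rewrite mulr_ge0 ?subr_ge0// ltW.
  lra.
rewrite ler_norml; apply/andP; split; lra.
Qed.

(** The constant 6 is chosen here: [5 * rho] is below 5 D / 6 and [D * rho] is at most D / 6, so (2
    + D) rho + 3 rho is at most D. *)
Lemma excess_large (rho L D : R) : 0 < rho -> rho <= 6^-1 -> 1 <= L -> 6 * rho < D ->
  2 * L + D <= L * excess rho D.
Proof.
move=> r0 r6 L1 rD.
have D0 : 0 < D by apply: lt_trans rD; rewrite mulr_gt0.
have H : 2 + D <= (D - 3 * rho) / rho.
  rewrite ler_pdivlMr//.
  have : D * rho <= D * 6^-1 by rewrite ler_pM2l.
  lra.
have := le_trans H (le_excess D r0) => {}H.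
apply: (@le_trans _ _ (L * (2 + D))); last by rewrite ler_pM2l// (lt_le_trans ltr01).
have : D <= L * D by rewrite ler_pMl.
lra.
Qed.

Lemma gap_large (rho L D x y : R) : 0 < rho -> rho <= 6^-1 -> 1 <= L -> 6 * rho < D ->
  0 < x -> 0 < y -> `|ln x - ln y| <= D ->
  expR (- (L * excess rho D)) * `|x - y| <= expR (- (2 * L)) * y.
Proof.
move=> r0 r6 L1 rD x0 y0 H; have HL := excess_large r0 r6 L1 rD.
apply: (@le_trans _ _ (expR (- (2 * L + D)) * (y * expR D))).
  rewrite ler_pM ?expR_ge0 ?ler_expR ?lerN2//.
  apply: le_trans (dist_le_expR_ln_dist x0 y0 H) _.
  by rewrite mulrC ler_pM2l// gerBl.
by rewrite mulrCA -expRD mulrC; have -> : - (2 * L + D) + D = - (2 * L) by lra.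
Qed.

(** Serves to bound the weighted prices: a distance up to [6 * rho] gives the factor
    [expR (6 * rho)], and beyond it the cost exceeds D and outweighs the growth. *)
Lemma gap_bound (rho L D x y : R) : 0 < rho -> rho <= 6^-1 -> 1 <= L ->
  0 < x -> 0 < y -> `|ln x - ln y| <= D ->
  expR (- (L * excess rho D)) * x <= expR (6 * rho) * y.
Proof.
move=> r0 r6 L1 x0 y0 H.
have L0 : 0 <= L by exact: le_trans L1.
apply: (@le_trans _ _ (expR (- (L * excess rho D)) * (y * expR D))).
  by rewrite ler_wpM2l ?expR_ge0// le_expR_ln_dist.
rewrite mulrCA -expRD mulrC ler_pM2r// ler_expR.
have [DL|DL] := leP D (6 * rho).
  have h : 0 <= L * excess rho D by rewrite mulr_ge0 ?excess_ge0.
  lra.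
by have := excess_large r0 r6 L1 DL; lra.
Qed.

(** The threshold is the solution of 1 - th = 1/(1 + e), which turns a gap relative to [x] into a
    ratio bound. *)
Lemma relative_gap (x y th e : R) : 0 < e -> th <= e / (1 + e) -> 0 <= x ->
  x <= y + th * x -> y <= x + th * x -> x <= (1 + e) * y /\ y <= (1 + e) * x.
Proof.
move=> e0 thle x0 H1 H2; have e1 : 0 < 1 + e by rewrite addr_gt0.
have thx : th * x <= e / (1 + e) * x by rewrite ler_wpM2r.
have h : e / (1 + e) * x * (1 + e) = e * x by field; rewrite gt_eqF.
split.
  have : x * (1 + e) <= (y + e / (1 + e) * x) * (1 + e).
    by rewrite ler_pM2r// (le_trans H1)// lerD2l.
  rewrite mulrDl h; lra.
have : e / (1 + e) * x <= e * x.
  by rewrite ler_wpM2r// ler_pdivrMr// ler_peMr ?ltW// ltrDl.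
lra.
Qed.

End PriceGap.

(** * The density, its measurability and the integrated price bounds *)

Section Density.
Context {d : measure_display} {Omega : measurableType d} {R : realType}.
Variables (P : probability Omega R) (T : R) (F : R -> set (set Omega)).
Variables (n : nat) (delta : R) (S : R -> Omega -> 'I_n -> R).
Hypothesis T0 : 0 < T.
Hypothesis sF : forall t, in_time T t -> sigma_algebra setT (F t).
Hypothesis Fm : forall t, in_time T t -> F t `<=` measurable.
Hypothesis Fle : forall s t, 0 <= s -> s <= t -> t <= T -> F s `<=` F t.
Hypothesis S_adapted : forall t i, in_time T t -> G_measurable (F t) (fun w => S t w i).
Hypothesis S_path : forall w, Cpath delta T (fun t => S t w).
Variables (rho eta : R) (p : R -> Omega -> R).
Hypothesis rho0 : 0 < rho.
Hypothesis rho6 : rho <= 6^-1.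
Hypothesis eta0 : 0 < eta.
Hypothesis Hp : forall t, in_time T t -> is_cond_prob P (F t) (freeze_event T delta S t rho) (p t).
Hypothesis m_freeze : forall t, in_time T t -> measurable (freeze_event T delta S t rho).
Hypothesis p_inf : forall w, exists2 lam, 0 < lam &
     forall q : rat, 0 <= q <= 1 -> lam <= p (grid T q) w.

(* Chosen so that expR (- rate) <= eta * p: paying one more unit of cost
   weighs at most eta times the probability of freezing. *)
Definition rate (w : Omega) (t : R) : R := Num.max 1 (- ln (eta * p t w)).
Definition path_dist (w : Omega) (a b : R) : R := log_dist (S a w) (S b w).
Definition max_rate (t : R) (w : Omega) : R := running_sup T (rate w) t.
Definition path_cost (w : Omega) : R -> R -> R := step_cost T rho (rate w) (path_dist w).
Definition path_variation (t : R) (w : Omega) : R := variation T (path_cost w) t.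
(* An F 0-measurable factor that makes density * S bounded. *)
Definition normalizer (w : Omega) : R := expR (- ln (1 + \sum_(i < n) S 0 w i)).
Definition density (w : Omega) : R := expR (- path_variation T w) * normalizer w.

Let S0 t w i : in_time T t -> 0 < S t w i.
Proof. by move=> tt; have [_ /(_ t tt)[+ _]] := S_path w; apply. Qed.

Let t00 : in_time T 0. Proof. by rewrite /in_time lexx ltW. Qed.
Let tTT : in_time T T. Proof. by rewrite /in_time lexx ltW. Qed.

Let rate1 w t : 1 <= rate w t. Proof. by rewrite le_max lexx. Qed.

Lemma rate_bounded w : exists B, forall q : rat, 0 <= q <= 1 -> rate w (grid T q) <= B.
Proof.
have [lam lam0 H] := p_inf w; exists (Num.max 1 (- ln (eta * lam))) => q q01.
have pq := lt_le_trans lam0 (H q q01).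
rewrite /rate ge_max le_max lexx/= le_max; apply/orP; right.
by rewrite lerN2 ler_ln ?posrE ?mulr_gt0// ler_pM2l// H.
Qed.

Lemma path_excess_lipschitz w : exists C, forall a b, 0 <= a -> a <= b -> b <= T ->
  excess rho (path_dist w a b) <= C * (b - a).
Proof.
apply: excess_lipschitz => //.
- by move=> a b; exact: log_dist_ge0.
- by move=> a b; exact: log_dist_sym.
- by move=> a b c; exact: log_dist_tri.
- exact: (Cpath_log_cont T0 (S_path w)).
Qed.

Let psym w a b : path_dist w a b = path_dist w b a. Proof. exact: log_dist_sym. Qed.
Let ptri w a b c : path_dist w a b <= path_dist w a c + path_dist w c b.
Proof. exact: log_dist_tri. Qed.

Lemma max_rate1 t w : 1 <= max_rate t w.
Proof. have [B HB] := rate_bounded w; exact: running_sup_ge1 HB t. Qed.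

Lemma path_variation_step q w : 0 <= q <= 1 ->
  path_variation (grid T q) w + path_cost w (grid T q) T <= path_variation T w.
Proof.
have [B HB] := rate_bounded w; have [C HC] := path_excess_lipschitz w.
by apply: (@variation_step R T rho (rate w) (path_dist w) B C).
Qed.

Lemma path_variation_freeze q w : 0 <= q <= 1 ->
  freeze_event T delta S (grid T q) rho w ->
  path_variation T w <= path_variation (grid T q) w + max_rate (grid T q) w.
Proof.
have [B HB] := rate_bounded w; have [C HC] := path_excess_lipschitz w.
move=> q01 [_ Hw]; apply: (@variation_freeze R T rho (rate w) (path_dist w) B C) => //.
by move=> s s1 s2; apply/ltW/Hw.
Qed.

Let up s t (f : Omega -> R) : in_time T s -> s <= t -> t <= T -> G_measurable (F s) f ->
  measurable_fun setT (f : g_sigma_algebraType (F t) -> R).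
Proof.
move=> /andP[s0 sT] st tT Gf.
have tt : in_time T t by rewrite /in_time (le_trans s0 st).
by apply/(G_measurableE (sF tt)) => B mB; apply: (Fle s0 st tT); exact: Gf.
Qed.

Lemma measurable_path_dist t a b : in_time T a -> in_time T b -> a <= t -> b <= t -> t <= T ->
  measurable_fun setT ((fun w => path_dist w a b) : g_sigma_algebraType (F t) -> R).
Proof.
move=> ta tb at_ bt tT; apply: measurable_sum => i.
apply: measurableT_comp; first exact: normr_measurable.
apply: measurable_funB; apply: (measurableT_comp (@measurable_ln R)).
- exact: (up ta at_ tT (S_adapted i ta)).
- exact: (up tb bt tT (S_adapted i tb)).
Qed.

Lemma measurable_max_rate t a : in_time T a -> a <= t -> t <= T ->
  measurable_fun setT (max_rate a : g_sigma_algebraType (F t) -> R).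
Proof.
move=> ta at_ tT; apply: (@measurable_csup _ (g_sigma_algebraType (F t)) rat R
  (fun q w => if (0 <= q <= 1) && (grid T q <= a) then rate w (grid T q) else 1) 0).
  move=> q; case: (boolP ((0 <= q <= 1) && (grid T q <= a))) => [/andP[/andP[q0 q1] qa]|_]; last exact: measurable_cst.
  have tq : in_time T (grid T q).
    by rewrite /in_time grid_leT// andbT mulr_ge0 ?(ltW T0)// ler0q.
  apply: measurable_maxr; first exact: measurable_cst.
  apply: measurableT_comp => //; apply: (measurableT_comp (@measurable_ln R)).
  apply: measurable_funM; first exact: measurable_cst.
  by apply: (up tq) => //; [exact: le_trans at_|case: (Hp tq)].
move=> w; have [B HB] := rate_bounded w; exists B => q.
case: ifPn => [/andP[q01 _]|_]; first exact: HB.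
by apply: le_trans (rate1 w 0) _; have := HB 0; rewrite /grid rmorph0 mulr0; apply.
Qed.

Lemma measurable_path_cost t a b : in_time T a -> in_time T b -> a <= t -> b <= t -> t <= T ->
  measurable_fun setT ((fun w => path_cost w a b) : g_sigma_algebraType (F t) -> R).
Proof.
move=> ta tb at_ bt tT; apply: measurable_funM; first exact: measurable_max_rate.
apply: measurable_funM; last exact: measurable_cst.
apply: measurable_maxr; first exact: measurable_cst.
by apply: measurable_funB; [exact: measurable_path_dist|exact: measurable_cst].
Qed.

(** Chains counted at time t stay in [0,t], so the cost accumulated by t is known at time t. *)
Lemma measurable_path_variation t : in_time T t ->
  measurable_fun setT (path_variation t : g_sigma_algebraType (F t) -> R).
Proof.
move=> tt; case/andP: (tt) => t0 tT.
have mchain l x : in_time T x -> x <= t -> path <=%R x l -> all (fun y => y <= t) l ->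
    measurable_fun setT
      ((fun w => chain_cost (path_cost w) x l) : g_sigma_algebraType (F t) -> R).
  elim: l x => [|y l IH] x tx xt /=; first by move=> _ _; exact: measurable_cst.
  move=> /andP[xy pyl] /andP[yt lt].
  have ty : in_time T y.
    by case/andP: tx => x0 _; rewrite /in_time (le_trans x0 xy) (le_trans yt).
  by apply: measurable_funD; [exact: measurable_path_cost|exact: IH].
apply: (@measurable_csup _ (g_sigma_algebraType (F t)) (seq rat) R
  (fun l w => grid_cost T (path_cost w) t l) [::]).
  move=> l; rewrite /grid_cost.
  case: (boolP (path _ _ _ && _)) => [/andP[pl lt]|_]; first exact: mchain.
  exact: measurable_cst.
move=> w; have [B HB] := rate_bounded w; have [C HC] := path_excess_lipschitz w.
exists (B * C * T) => l.
exact: (@grid_cost_le R T rho (rate w) (path_dist w) B C).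
Qed.

Lemma normalizer_gt0 w : 0 < normalizer w. Proof. exact: expR_gt0. Qed.

Lemma normalizer_le w i : normalizer w * S 0 w i <= 1.
Proof.
have s0 : 0 <= \sum_(i < n) S 0 w i by apply: sumr_ge0 => j _; exact/ltW/S0.
have p1 : 0 < 1 + \sum_(i < n) S 0 w i by rewrite ltr_pwDl.
rewrite /normalizer expRN lnK ?posrE// mulrC ler_pdivrMr// mul1r.
rewrite (bigD1 i)//= addrCA lerDl addr_ge0//.
by apply: sumr_ge0 => j _; exact/ltW/S0.
Qed.

Lemma normalizer_le1 w : normalizer w <= 1.
Proof.
have s0 : 0 <= \sum_(i < n) S 0 w i by apply: sumr_ge0 => j _; exact/ltW/S0.
have p1 : 0 < 1 + \sum_(i < n) S 0 w i by rewrite ltr_pwDl.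
by rewrite /normalizer expRN lnK ?posrE// invf_le1// lerDl.
Qed.

Lemma measurable_normalizer t : in_time T t ->
  measurable_fun setT (normalizer : g_sigma_algebraType (F t) -> R).
Proof.
case/andP=> t0 tT.
apply: measurableT_comp; first exact: measurable_expR.
apply: measurableT_comp => //; apply: (measurableT_comp (@measurable_ln R)).
apply: measurable_funD; first exact: measurable_cst.
by apply: measurable_sum => i; exact: (up t00 t0 tT (S_adapted i t00)).
Qed.

Lemma density_gt0 w : 0 < density w.
Proof. by rewrite mulr_gt0 ?expR_gt0. Qed.

Lemma measurable_density : measurable_fun setT density.
Proof.
apply: (G_measurable_measurable (Fm tTT)); apply/(G_measurableE (sF tTT)).
apply: measurable_funM; last exact: measurable_normalizer.
apply: measurableT_comp; first exact: measurable_expR.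
by apply: measurableT_comp => //; exact: measurable_path_variation.
Qed.

Lemma density_le1 w : density w <= 1.
Proof.
rewrite -[leRHS]mulr1 ler_pM ?expR_ge0 ?(ltW (normalizer_gt0 w)) ?normalizer_le1//.
rewrite -expR0 ler_expR oppr_le0.
have [B HB] := rate_bounded w; have [C HC] := path_excess_lipschitz w.
exact: (@variation_ge0 R T rho (rate w) (path_dist w) B C).
Qed.

(** The single step from 0 to [grid T q] already pays for the growth of the price relative to [S 0],
    and the normalizer bounds [S 0]. *)
Lemma density_price_le q w i : 0 <= q <= 1 ->
  density w * S (grid T q) w i <= expR (6 * rho).
Proof.
move=> q01; have /andP[q0 q1] := q01.
have tq : in_time T (grid T q).
  by rewrite /in_time grid_leT// andbT mulr_ge0 ?(ltW T0)// ler0q.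
have [B HB] := rate_bounded w; have [C HC] := path_excess_lipschitz w.
have V1 : path_cost w 0 (grid T q) <= path_variation T w.
  apply: (@le_trans _ _ (path_variation (grid T q) w)).
    have /andP[tq0 tq1] := tq.
    have := @grid_cost_variation R T rho (rate w) (path_dist w) B C T0 rho0
      (rate1 w) HB HC (grid T q) [:: q] tq1.
    by rewrite /grid_cost /= tq0 lexx/= addr0.
  apply: le_trans (path_variation_step w q01); rewrite lerDl.
  exact: (@step_cost_ge0 R T rho (rate w) (path_dist w) B).
have H := @gap_bound R rho (max_rate 0 w) (path_dist w 0 (grid T q))
  (S (grid T q) w i) (S 0 w i) rho0 rho6 (max_rate1 0 w) (S0 w i tq) (S0 w i t00) _.
have {}H := H (le_trans (log_dist_ge _ _ i) _).
apply: (@le_trans _ _ (normalizer w * (expR (6 * rho) * S 0 w i))); last first.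
  by rewrite mulrCA -[leRHS]mulr1 ler_pM2l ?expR_gt0// normalizer_le.
rewrite /density mulrAC mulrC ler_pM2l ?normalizer_gt0//.
apply: le_trans (H _); last by rewrite psym.
by rewrite ler_pM2r ?S0// ler_expR lerN2.
Qed.

Let mS t i : in_time T t -> measurable_fun setT (fun w => S t w i).
Proof. by move=> tt; exact: (G_measurable_measurable (Fm tt) (S_adapted i tt)). Qed.

(* A path that moves far after t pays at least twice the maximal rate L, a path
   frozen at t at most once; the second L absorbs the conditional probability of
   freezing. *)
Lemma density_gap q i A : 0 <= q <= 1 -> F (grid T q) A ->
  (\int[P]_(w in A) (density w * `|S T w i - S (grid T q) w i|)%:E <=
   (expR (6 * rho) - 1 + eta)%:E * \int[P]_(w in A) (density w * S (grid T q) w i)%:E)%E.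
Proof.
move=> q01; have /andP[q0 q1] := q01; set t := grid T q => FA.
have tt : in_time T t.
  by rewrite /in_time grid_leT// andbT mulr_ge0 ?(ltW T0)// ler0q.
have /andP[t0 tT] := tt.
have mA := Fm tt FA.
have [pG p0 pE] := Hp tt.
pose B := freeze_event T delta S t rho.
have mB : measurable B by exact: m_freeze.
pose kappa := expR (6 * rho) - 1.
have k0 : 0 <= kappa by rewrite subr_ge0 -expR0 ler_expR mulr_ge0// ltW.
pose V := path_variation t; pose L := max_rate t.
(* A lower bound, known at time t, for the weighted price on the paths that freeze at t. *)
pose h1 w := expR (- (V w + L w)) * S t w i * normalizer w.
have h10 w : 0 <= h1 w by rewrite !mulr_ge0 ?expR_ge0 ?(ltW (S0 w i tt)).
have Gh1 : G_measurable (F t) h1.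
  apply/(G_measurableE (sF tt)).
  apply: measurable_funM; last exact: measurable_normalizer.
  apply: measurable_funM; last exact/(G_measurableE (sF tt))/S_adapted.
  apply: measurableT_comp; first exact: measurable_expR.
  apply: measurableT_comp => //; apply: measurable_funD.
    exact: measurable_path_variation.
  exact: measurable_max_rate.
have mh1 := G_measurable_measurable (Fm tt) Gh1.
have mp := G_measurable_measurable (Fm tt) pG.
have mZ := measurable_density.
have mSt := mS i tt; have mST := mS i tTT.
have Z0 w : 0 <= density w := ltW (density_gt0 w).
(* Near moves, up to [6 * rho], give the [kappa] term; far moves give the [eta] term. *)
have pointwise w : density w * `|S T w i - S t w i| <=
    kappa * (density w * S t w i) + eta * (h1 w * p t w).
  have [lam lam0 Hlam] := p_inf w.
  have pt0 : 0 < p t w := lt_le_trans lam0 (Hlam q q01).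
  have ld := log_dist_ge (S T w) (S t w) i.
  have hp0 : 0 <= eta * (h1 w * p t w).
    by apply: mulr_ge0; [exact: ltW|exact: mulr_ge0].
  have ks0 : 0 <= kappa * (density w * S t w i).
    by do 2 (apply: mulr_ge0 => //); exact/ltW/S0.
  have [DL|DL] := leP (path_dist w t T) (6 * rho).
    apply: (@le_trans _ _ (kappa * (density w * S t w i))); last first.
      by rewrite lerDl.
    rewrite mulrCA ler_wpM2l//.
    apply: le_trans (dist_le_expR_ln_dist (S0 w i tTT) (S0 w i tt) ld) _.
    rewrite ler_pM2r ?S0// lerD2r ler_expR; apply: le_trans DL.
    by rewrite psym.
  apply: (@le_trans _ _ (eta * (h1 w * p t w))); last first.
    by rewrite lerDr.
  have eL : expR (- L w) <= eta * p t w.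
    have epos : 0 < eta * p t w by rewrite mulr_gt0.
    rewrite -[leRHS]lnK ?posrE// ler_expR lerNl.
    have [C HC] := rate_bounded w.
    apply: (@le_trans _ _ (rate w t)).
      by rewrite /rate le_max lexx orbT.
    exact: (running_sup_ge (rate1 w) HC q01 (lexx t)).
  have VT : V w + L w * excess rho (path_dist w t T) <= path_variation T w.
    exact: path_variation_step.
  have gap := gap_large rho0 rho6 (max_rate1 t w) DL (S0 w i tTT) (S0 w i tt).
  have {}gap := gap (le_trans ld _).
  apply: (@le_trans _ _ (expR (- V w) * normalizer w *
     (expR (- (2 * L w)) * S t w i))).
    apply: le_trans (_ : _ <= expR (- V w) * normalizer w *
      (expR (- (L w * excess rho (path_dist w t T))) * `|S T w i - S t w i|)) _.
      have -> : expR (- V w) * normalizer w *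
          (expR (- (L w * excess rho (path_dist w t T))) * `|S T w i - S t w i|) =
          (expR (- V w) * expR (- (L w * excess rho (path_dist w t T)))) *
            (normalizer w * `|S T w i - S t w i|) by ring.
      rewrite /density -mulrA ler_wpM2r ?mulr_ge0 ?expR_ge0//.
      by rewrite -expRD ler_expR; move: VT; lra.
    rewrite ler_wpM2l ?mulr_ge0 ?expR_ge0// gap//.
    by rewrite psym.
  have -> : expR (- V w) * normalizer w * (expR (- (2 * L w)) * S t w i) =
      h1 w * expR (- L w).
    rewrite /h1 !opprD; have -> : - (2 * L w) = - L w + - L w by lra.
    by rewrite !expRD; ring.
  by rewrite mulrCA ler_wpM2l.
have frozen w : h1 w * \1_B w <= density w * S t w i.
  rewrite indicE; have [Bw|Bw] := pselect (B w); last first.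
    by rewrite memNset// mulr0 mulr_ge0// ltW ?S0.
  rewrite mem_set// mulr1 /h1 -mulrA [S t w i * _]mulrC /density -mulrA.
  rewrite ler_wpM2r ?mulr_ge0 ?(ltW (normalizer_gt0 w)) ?(ltW (S0 w i tt))//.
  rewrite ler_expR lerN2.
  exact: path_variation_freeze.
(* Since [h1] is known at time t, [p t] may be exchanged for the indicator of freezing, where [h1]
   lies below the weighted price. *)
have intE : (\int[P]_(w in A) (h1 w * p t w)%:E = \int[P]_(w in A) (h1 w * \1_B w)%:E)%E.
  apply: (@integral_mul_eq _ _ _ (F t) (sF tt) (Fm tt)) => //.
  by move=> A' FA'; rewrite -pE// integral_indic//; exact: Fm FA'.
have step2 : (\int[P]_(w in A) (h1 w * p t w)%:E <=
    \int[P]_(w in A) (density w * S t w i)%:E)%E.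
  rewrite intE; apply: ge0_le_integral => //.
  - by move=> w _; rewrite lee_fin mulr_ge0// indicE.
  - by apply/measurable_EFinP/measurable_funTS/measurable_funM.
  - by apply/measurable_EFinP/measurable_funTS/measurable_funM.
  - by move=> w _; rewrite lee_fin frozen.
apply: (@le_trans _ _ (\int[P]_(w in A)
   (kappa * (density w * S t w i) + eta * (h1 w * p t w))%:E)%E).
  apply: ge0_le_integral => //.
  - by move=> w _; rewrite lee_fin mulr_ge0.
  - apply/measurable_EFinP/measurable_funTS/measurable_funM => //.
    by apply: measurableT_comp => //; exact: measurable_funB.
  - apply/measurable_EFinP/measurable_funTS/measurable_funD;
      apply: measurable_funM => //; exact: measurable_funM.
  - by move=> w _; rewrite lee_fin pointwise.
have ZS0 w : 0 <= density w * S t w i by apply: mulr_ge0 => //; exact/ltW/S0.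
have hp0 w : 0 <= h1 w * p t w by apply: mulr_ge0.
have mZS : measurable_fun A (fun w => (density w * S t w i)%:E).
  by apply/measurable_EFinP/measurable_funTS/measurable_funM.
have mhp : measurable_fun A (fun w => (h1 w * p t w)%:E).
  by apply/measurable_EFinP/measurable_funTS/measurable_funM.
have linear : (\int[P]_(w in A) (kappa * (density w * S t w i) + eta * (h1 w * p t w))%:E =
    kappa%:E * \int[P]_(w in A) (density w * S t w i)%:E +
    eta%:E * \int[P]_(w in A) (h1 w * p t w)%:E)%E.
  rewrite -!ge0_integralZl ?lee_fin ?(ltW eta0)//.
  - rewrite -ge0_integralD//.
    + by move=> w _; rewrite -EFinM lee_fin; apply: mulr_ge0.
    + exact: measurable_funeM.
    + by move=> w _; rewrite -EFinM lee_fin; apply: mulr_ge0 => //; exact: ltW.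
    + exact: measurable_funeM.
  - by move=> w _; rewrite lee_fin.
  - by move=> w _; rewrite lee_fin.
rewrite linear -/kappa (EFinD kappa eta) (@ge0_muleDl _ _ kappa%:E eta%:E) ?lee_fin ?(ltW eta0)//.
by apply: leeD2l; rewrite lee_wpmul2l// lee_fin ltW.
Qed.

(** The approximation is from the right because a set of [F t] stays in the filtration at later grid
    times, where the bounds are known. *)
Lemma grid_right_approx t : in_time T t -> exists u : nat -> rat,
  forall k, 0 <= u k <= 1 /\ t <= grid T (u k) /\ grid T (u k) - t < k.+1%:R^-1.
Proof.
move=> /andP[t0 tT].
suff H k : exists q : rat, 0 <= q <= 1 /\ t <= grid T q /\ grid T q - t < k.+1%:R^-1.
  by have [u Hu] := choice H; exists u.
move: tT; rewrite le_eqVlt => /orP[/eqP ->|tT].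
  by exists 1; rewrite lexx ler01 /grid rmorph1 mulr1 lexx subrr invr_gt0.
have k0 : 0 < k.+1%:R^-1 :> R by rewrite invr_gt0.
have lt1 : t / T < Num.min 1 ((t + k.+1%:R^-1) / T).
  by rewrite lt_min ltr_pdivrMr// mul1r tT ltr_pM2r ?invr_gt0// ltrDl.
have [q] := rat_in_itvoo lt1; rewrite in_itv/= lt_min => /andP[tq /andP[q1 qk]].
exists q; split.
  apply/andP; split.
    by rewrite -(ler0q R) (le_trans _ (ltW tq))// divr_ge0// ltW.
  by rewrite -(ler_rat R) rmorph1 ltW.
split; first by move: tq; rewrite ltr_pdivrMr// mulrC => /ltW.
by move: qk; rewrite ltr_pdivlMr// mulrC /grid ltrBlDl.
Qed.

Let tgrid q : 0 <= q <= 1 -> in_time T (grid T q).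
Proof.
move=> /andP[q0 q1].
by rewrite /in_time grid_leT// andbT mulr_ge0 ?(ltW T0)// ler0q.
Qed.

Let mZS t i : in_time T t -> measurable_fun setT (fun w => density w * S t w i).
Proof. by move=> tt; apply: measurable_funM; [exact: measurable_density|exact: mS]. Qed.

Let ZS0 t w i : in_time T t -> 0 <= density w * S t w i.
Proof. by move=> tt; apply: mulr_ge0; [exact/ltW/density_gt0|exact/ltW/S0]. Qed.

Lemma density_price_integral_fin q i A : 0 <= q <= 1 -> measurable A ->
  (\int[P]_(w in A) (density w * S (grid T q) w i)%:E \is a fin_num)%E.
Proof.
move=> q01 mA; rewrite ge0_fin_numE; last first.
  by apply: integral_ge0 => w _; rewrite lee_fin; exact/ZS0/tgrid.
apply: (@le_lt_trans _ _ (\int[P]_(w in A) (expR (6 * rho))%:E)%E).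
  apply: ge0_le_integral => //.
  - by move=> w _; rewrite lee_fin; exact/ZS0/tgrid.
  - by apply/measurable_EFinP/measurable_funTS/mZS/tgrid.
  - by move=> w _; rewrite lee_fin density_price_le.
by rewrite integral_cst// lte_mul_pinfty ?lee_fin ?expR_ge0// ltey_eq fin_num_measure.
Qed.

(** The constant of [density_price_le] dominates, all approximating times being on the grid. *)
Lemma density_price_cvg t i A (u : nat -> rat) : in_time T t -> measurable A ->
  (forall k, 0 <= u k <= 1 /\ t <= grid T (u k) /\ grid T (u k) - t < k.+1%:R^-1) ->
  (\int[P]_(w in A) (density w * S (grid T (u k)) w i)%:E)%E @[k --> \oo] -->
  (\int[P]_(w in A) (density w * S t w i)%:E)%E.
Proof.
move=> tt mA Hu.
have u01 k : 0 <= u k <= 1 by case: (Hu k).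
have [] := @dominated_convergence _ Omega R P A mA
  (fun k w => (density w * S (grid T (u k)) w i)%:E)
  (fun w => (density w * S t w i)%:E) (cst (expR (6 * rho))%:E).
- by move=> k; apply/measurable_EFinP/measurable_funTS/mZS/tgrid.
- by apply/measurable_EFinP/measurable_funTS/mZS.
- apply: aeW => w _; apply: cvg_EFin; first by apply: nearW.
  apply: cvgMr; apply/cvgrPdist_lt => e e0.
  have [Sc _] := S_path w.
  have [h h0 Hh] := (within_continuous_eps T _).1 (Sc i) t tt e e0.
  have [N] := ltr_add_invr h0; rewrite add0r => HN.
  exists N => // k /= Nk; apply: Hh; first exact: tgrid.
  have [_ [tk kt]] := Hu k.
  rewrite distrC ger0_norm ?subr_ge0//; apply: lt_trans kt _.
  apply: le_lt_trans HN; rewrite lef_pV2 ?posrE//.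
  by rewrite ler_nat.
- exact: finite_measure_integrable_cst.
- apply: aeW => w k _; rewrite gee0_abs lee_fin; last exact/ZS0/tgrid.
  exact: density_price_le.
by [].
Qed.

Variable e : R.
Hypothesis e0 : 0 < e.
Hypothesis theta_le : expR (6 * rho) - 1 + eta <= e / (1 + e).

Let grid1 : grid T 1 = T. Proof. by rewrite /grid rmorph1 mulr1. Qed.

Lemma density_price_grid q i A : 0 <= q <= 1 -> F (grid T q) A ->
  ((\int[P]_(w in A) (density w * S (grid T q) w i)%:E
    <= (1 + e)%:E * \int[P]_(w in A) (density w * S T w i)%:E) /\
   (\int[P]_(w in A) (density w * S T w i)%:E
    <= (1 + e)%:E * \int[P]_(w in A) (density w * S (grid T q) w i)%:E))%E.
Proof.
move=> q01 FA; have tt := tgrid q01; have mA := Fm tt FA.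
have gap := density_gap i q01 FA.
have fx := density_price_integral_fin i q01 mA.
have fy : (\int[P]_(w in A) (density w * S T w i)%:E \is a fin_num)%E.
  by have := @density_price_integral_fin 1 i A; rewrite grid1; apply; rewrite // lexx ler01.
have mD : measurable_fun A (fun w => (density w * `|S T w i - S (grid T q) w i|)%:E).
  apply/measurable_EFinP/measurable_funTS/measurable_funM; first exact: measurable_density.
  by apply: measurableT_comp => //; apply: measurable_funB; exact: mS.
have D0 w : 0 <= density w * `|S T w i - S (grid T q) w i|.
  by apply: mulr_ge0 => //; exact/ltW/density_gt0.
have le_add t s : in_time T t -> in_time T s ->
    (forall w, S t w i <= S s w i + `|S T w i - S (grid T q) w i|) ->
    (\int[P]_(w in A) (density w * S t w i)%:E <=
    \int[P]_(w in A) (density w * S s w i)%:E +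
    \int[P]_(w in A) (density w * `|S T w i - S (grid T q) w i|)%:E)%E.
  move=> t1 t2 H; rewrite -ge0_integralD//.
  - apply: ge0_le_integral => //.
    + by move=> w _; rewrite lee_fin ZS0.
    + by apply/measurable_EFinP/measurable_funTS/mZS.
    + by apply: emeasurable_funD => //; apply/measurable_EFinP/measurable_funTS/mZS.
    + move=> w _; rewrite -EFinD lee_fin -mulrDr ler_wpM2l//.
      exact/ltW/density_gt0.
  - by move=> w _; rewrite lee_fin ZS0.
  - by apply/measurable_EFinP/measurable_funTS/mZS.
  - by move=> w _; rewrite lee_fin.
have H1 := le_add (grid T q) T tt tTT _.
have {}H1 := le_trans (H1 (fun w => _)) (leeD2l _ gap).
have H2 := le_add T (grid T q) tTT tt _.
have {}H2 := le_trans (H2 (fun w => _)) (leeD2l _ gap).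
have x0 : (0 <= \int[P]_(w in A) (density w * S (grid T q) w i)%:E)%E.
  by apply: integral_ge0 => w _; rewrite lee_fin ZS0.
have {}H1 : (\int[P]_(w in A) (density w * S (grid T q) w i)%:E <=
  \int[P]_(w in A) (density w * S T w i)%:E + (expR (6 * rho) - 1 + eta)%:E *
  \int[P]_(w in A) (density w * S (grid T q) w i)%:E)%E.
  apply: H1 => w.
  by have := ler_norm (S (grid T q) w i - S T w i); rewrite distrC; lra.
have {}H2 : (\int[P]_(w in A) (density w * S T w i)%:E <=
  \int[P]_(w in A) (density w * S (grid T q) w i)%:E + (expR (6 * rho) - 1 + eta)%:E *
  \int[P]_(w in A) (density w * S (grid T q) w i)%:E)%E.
  apply: H2 => w.
  by have := ler_norm (S T w i - S (grid T q) w i); lra.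
move: x0 H1 H2; rewrite -(fineK fx) -(fineK fy) -!EFinM -!EFinD !lee_fin.
exact: relative_gap.
Qed.

Lemma density_price_le_all t i A : in_time T t -> F t A ->
  (\int[P]_(w in A) (density w * S t w i)%:E
    <= (1 + e)%:E * \int[P]_(w in A) (density w * S T w i)%:E)%E.
Proof.
move=> tt FA; have mA := Fm tt FA; have [u Hu] := grid_right_approx tt.
have cv := @density_price_cvg t i A u tt mA Hu.
rewrite -(cvg_lim _ cv)//; apply: lime_le; first exact: cvgP cv.
apply: nearW => k; have [u01 [tk _]] := Hu k.
have /andP[t0 tT] := tt; have /andP[_ uT] := tgrid u01.
by have [] := density_price_grid i u01 (Fle t0 tk uT FA).
Qed.

Lemma density_price_ge_all t i A : in_time T t -> F t A ->
  (\int[P]_(w in A) (density w * S T w i)%:E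
    <= (1 + e)%:E * \int[P]_(w in A) (density w * S t w i)%:E)%E.
Proof.
move=> tt FA; have mA := Fm tt FA; have [u Hu] := grid_right_approx tt.
have cv := cvgeZl (isT : ((1 + e)%:E \is a fin_num)%E) (@density_price_cvg t i A u tt mA Hu).
rewrite -(cvg_lim _ cv)//; apply: lime_ge; first exact: cvgP cv.
apply: nearW => k; have [u01 [tk _]] := Hu k.
have /andP[t0 tT] := tt; have /andP[_ uT] := tgrid u01.
by have [] := density_price_grid i u01 (Fle t0 tk uT FA).
Qed.

End Density.

Theorem theorem1 (R : realType) (d : measure_display) (Omega : measurableType d)
  (P : probability Omega R) (T : R) (F : R -> set (set Omega))
  (n : nat) (delta : R) (S : R -> Omega -> 'I_n -> R) :
  0 < T -> usual_filtration P T F ->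
  (1 <= n)%N -> 0 < delta < 1 ->
  cont_adapted_O delta T F S -> CFS delta T P F S ->
  forall eps : R, 0 < eps ->
    exists St : R -> Omega -> 'I_n -> R, exists Q : probability Omega R,
      eps_CPS T eps P F S St Q /\
      (forall w t, in_time T t -> Oset delta (St t w)).
Proof.
move=> T0 [FsF Fle _ [_ F_null] _] n0 delta01 [S_adapted S_cont S_O] S_CFS eps eps0.
have sF t : in_time T t -> sigma_algebra setT (F t) by move=> /FsF[].
have Fm t : in_time T t -> F t `<=` measurable by move=> /FsF[].
have S_path w : Cpath delta T (fun t => S t w).
  by split; [exact: S_cont|exact: S_O].
(* The tolerance of [relative_gap] is split in halves: [eta] for far moves and, through [rho],
   [expR (6 * rho) - 1 <= eta] for near ones. The cap [6^-1] on [rho] is the one required by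
   [excess_large]. *)
pose theta := eps / (1 + eps).
have theta0 : 0 < theta by rewrite divr_gt0// addr_gt0.
pose eta := theta / 2; have eta0 : 0 < eta by rewrite divr_gt0.
have ln0 : 0 < ln (1 + eta) by rewrite ln_gt0// ltrDl.
pose rho := Num.min 6^-1 (ln (1 + eta) / 6).
have rho0 : 0 < rho by rewrite lt_min invr_gt0 divr_gt0 ?andbT.
have rho6 : rho <= 6^-1 by rewrite ge_min lexx.
have theta_le : expR (6 * rho) - 1 + eta <= theta.
  have : expR (6 * rho) <= 1 + eta.
    rewrite -[leRHS]lnK ?posrE ?addr_gt0// ler_expR.
    by rewrite mulrC -ler_pdivlMr// ge_min lexx orbT.
  rewrite /eta; lra.
have [p [Hp p_inf]] := freeze_probability T0 sF Fm Fle F_null S_path S_CFS rho0.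
have m_freeze t : in_time T t -> measurable (freeze_event T delta S t rho).
  move=> /andP[t0 tT].
  by have [] := freeze_cond_prob T0 sF Fm S_path S_CFS rho t0 (lexx t) tT.
have tTT : in_time T T by rewrite /in_time lexx ltW.
have mZ : measurable_fun setT (density T S rho eta p).
  by apply: measurable_density; eassumption.
apply: (eps_CPS_of_density T0 sF Fm Fle delta01 S_adapted S_O eps0
  (Z := density T S rho eta p)) => //.
- by move=> w; exact: density_gt0.
- apply: (@le_lt_trans _ _ (\int[P]_w 1%:E)%E); last first.
    by rewrite integral_cst// mul1e ltey_eq fin_num_measure.
  apply: ge0_le_integral => //.
  + by move=> w _; rewrite lee_fin; exact/ltW/density_gt0.
  + exact/measurable_EFinP.
  + by move=> w _; rewrite lee_fin; apply: density_le1; eassumption.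
- move=> i.
  have : (\int[P]_(w in setT) (density T S rho eta p w * S (grid T 1) w i)%:E \is a fin_num)%E.
    by apply: density_price_integral_fin; try eassumption; rewrite ?lexx ?ler01.
  by rewrite /grid rmorph1 mulr1 fin_numElt => /andP[].
- by move=> t i A; apply: density_price_le_all; eassumption.
- by move=> t i A; apply: density_price_ge_all; eassumption.
Qed.
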